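(* Let $\kappa$ be a field and let $\Gamma<\mathbb{R}$ be a finitely generated subgroup that is discrete. Then every filtered matched pair (with respect to $\kappa$ and $\Gamma$) has a doubly-orthogonal basis.
   Context: $\Lambda=\kappa[\Gamma]$ is the group algebra, written as finite sums $\sum_{g\in\Gamma}a_gT^g$, $a_g\in\kappa$. $\Lambda_{\uparrow}$ (resp. $\Lambda^{\downarrow}$) is the field of formal sums $\sum_{g\in\Gamma}a_gT^g$ such that for every $C\in\mathbb{R}$ only finitely many $g$ with $g<C$ (resp. $g>-C$) have $a_g\ne0$. $\nu_{\uparrow}(\sum a_gT^g)=\min\{g: a_g\neq 0\}$ on $\Lambda_{\uparrow}$ ($\nu_\uparrow(0)=+\infty$), $\nu^{\downarrow}(\sum a_gT^g)=\max\{g:a_g\ne0\}$ on $\Lambda^{\downarrow}$ ($\nu^{\downarrow}(0)=-\infty$). A normed $\Lambda_{\uparrow}$-space $(V_{\uparrow},\rho_{\uparrow})$ is a finite-dimensional $\Lambda_{\uparrow}$-vector space with $\rho_{\uparrow}:V_{\uparrow}\to\mathbb{R}\cup\{-\infty\}$ such that $\rho_{\uparrow}(x)=-\infty$ iff $x=0$; $\rho_{\uparrow}(\lambda x)=\rho_{\uparrow}(x)-\nu_{\uparrow}(\lambda)$; $\rho_{\uparrow}(x+y)\le\max\{\rho_{\uparrow}(x),\rho_{\uparrow}(y)\}$. A normed $\Lambda^{\downarrow}$-space $(V^{\downarrow},\rho^{\downarrow})$ is a finite-dimensional $\Lambda^{\downarrow}$-vector space with $\rho^{\downarrow}:V^{\downarrow}\to\mathbb{R}\cup\{\infty\}$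 such that $\rho^{\downarrow}(x)=\infty$ iff $x=0$; $\rho^{\downarrow}(\lambda x)=\rho^{\downarrow}(x)-\nu^{\downarrow}(\lambda)$; $\rho^{\downarrow}(x+y)\ge\min\{\rho^{\downarrow}(x),\rho^{\downarrow}(y)\}$. A subset $\{x_1,\dots,x_k\}$ is $\rho_{\uparrow}$-orthogonal if $\rho_{\uparrow}(\sum\lambda_ix_i)=\max_i(\rho_{\uparrow}(x_i)-\nu_{\uparrow}(\lambda_i))$ for all $\lambda_i\in\Lambda_{\uparrow}$, and $\rho^{\downarrow}$-orthogonal if $\rho^{\downarrow}(\sum\lambda_ix_i)=\min_i(\rho^{\downarrow}(x_i)-\nu^{\downarrow}(\lambda_i))$ for all $\lambda_i\in\Lambda^{\downarrow}$. A filtered matched pair consists of a finitely generated $\Lambda$-module $H$, a normed $\Lambda_{\uparrow}$-space $(V_{\uparrow},\rho_{\uparrow})$, a normed $\Lambda^{\downarrow}$-space $(V^{\downarrow},\rho^{\downarrow})$, and $\Lambda$-module homomorphisms $\phi_{\uparrow}:H\to V_{\uparrow}$, $\phi^{\downarrow}:H\to V^{\downarrow}$ such that $1\otimes\phi_{\uparrow}:\Lambda_{\uparrow}\otimes_{\Lambda}H\to V_{\uparrow}$ and $1\otimes\phi^{\downarrow}:\Lambda^{\downarrow}\otimes_{\Lambda}H\to V^{\downarrow}$ are isomorphisms. A doubly-orthogonal basis of it is a subset $\{e_1,\dots,e_d\}\subset H$ which projects to a basis of the $\Lambda$-module $H/tH$ ($tH$ the $\Lambda$-torsion submodule) and such that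 $\{\phi_{\uparrow}(e_1),\dots,\phi_{\uparrow}(e_d)\}$ is a $\rho_{\uparrow}$-orthogonal basis of $V_{\uparrow}$ and $\{\phi^{\downarrow}(e_1),\dots,\phi^{\downarrow}(e_d)\}$ is a $\rho^{\downarrow}$-orthogonal basis of $V^{\downarrow}$. *)

(* Defs.v *)
From HB Require Import structures.
From mathcomp Require Import all_boot all_order all_algebra finmap.
From mathcomp Require Import generic_quotient ring_quotient.
From mathcomp Require Import boolp classical_sets functions cardinality fsbigop.
From mathcomp Require Import reals ereal topology normedtype.

Set Implicit Arguments.
Unset Strict Implicit.
Unset Printing Implicit Defensive.

Import Order.TTheory GRing.Theory Num.Theory.
Import numFieldNormedType.Exports.

Local Open Scope classical_set_scope.
Local Open Scope quotient_scope.
Local Open Scope ring_scope.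

(* Families of subsets of R that can serve as supports of formal sums
   [\sum_g a_g T^g]: the closure properties make such sums a ring. *)
Record supports (R : realType) := Supports {
  supports_mem :> set R -> Prop;
  supports1 : supports_mem [set 0];
  supportsS : forall A B, A `<=` B -> supports_mem B -> supports_mem A;
  supportsU : forall A B,
    supports_mem A -> supports_mem B -> supports_mem (A `|` B);
  supportsD : forall A B, supports_mem A -> supports_mem B ->
    supports_mem [set x + y | x in A & y in B];
  supports_fin : forall A B x, supports_mem A -> supports_mem B ->
    finite_set (A `&` [set y | B (x - y)]) }.

Section FormalSums.
Variables (R : realType) (K : fieldType) (S : supports R).
Implicit Types (f g h : R -> K).

Definition supp f : set R := [set x | f x != 0].

Lemma suppE f x : supp f x = (f x != 0). Proof. by []. Qed.

Lemma suppPn f x : ~ supp f x -> f x = 0.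
Proof. by rewrite /supp /= => /negP; rewrite negbK => /eqP. Qed.

Definition supported_in : {pred R -> K} := fun f => `[< S (supp f) >].

Fact supported_in_zmod_closed : zmod_closed supported_in.
Proof.
split=> [|f g /asboolP Sf /asboolP Sg]; apply/asboolP.
  by apply: supportsS (supports1 S) => x; rewrite /supp /= eqxx.
apply: supportsS (supportsU Sf Sg) => x.
apply: contraPP => /not_orP[/suppPn fx /suppPn gx].
by apply/negP; rewrite negbK -[_ x]/(f x - g x) fx gx subrr.
Qed.
HB.instance Definition _ :=
  GRing.isZmodClosed.Build (R -> K) supported_in supported_in_zmod_closed.

(* The formal sum [\sum_g a_g T^g] is encoded by the function [g |-> a_g] on R;
   the families used below only allow supports contained in the subgroup. *)
Record fsum := FSum { coef :> R -> K; coefP : coef \in supported_in }.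
HB.instance Definition _ := [isSub for coef].
HB.instance Definition _ := [Choice of fsum by <:].
HB.instance Definition _ := [SubChoice_isSubZmodule of fsum by <:].

Lemma coef_supp (a : fsum) : S (supp a).
Proof. exact/asboolP/coefP. Qed.

Lemma fsumP (a b : fsum) : (forall x, a x = b x) <-> a = b.
Proof. by split=> [ab|-> //]; apply/val_inj/funext. Qed.

Lemma supp_neq0 (a : fsum) : a != 0 -> supp a !=set0.
Proof.
move=> a0; apply: contra_notP (negP a0) => ne.
by apply/eqP/fsumP => x; apply: suppPn => ax; apply: ne; exists x.
Qed.

Lemma coefD (a b : fsum) x : (a + b : fsum) x = a x + b x. Proof. by []. Qed.
Lemma coefN (a : fsum) x : (- a : fsum) x = - a x. Proof. by []. Qed.
Lemma coef0 x : (0 : fsum) x = 0. Proof. by []. Qed.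

Definition convolution f g : R -> K :=
  fun x => \sum_(y \in [set: R]) f y * g (x - y).

(* The finitely supported sums defining a product may be computed over any
   finite set containing the relevant indices. *)
Lemma fsbig_over (F : R -> K) (A : set R) : finite_set A -> supp F `<=` A ->
  \sum_(y \in [set: R]) F y = \sum_(y <- fset_set A) F y.
Proof.
move=> fA sA; apply: fsbigTE => y; rewrite in_fset_set// notin_setE => nAy.
by apply: suppPn => /sA.
Qed.

Definition meet_at (A B : set R) x : set R := A `&` [set y | B (x - y)].

Lemma supp_mul f g x : supp (fun y => f y * g (x - y)) `<=` meet_at (supp f) (supp g) x.
Proof. by move=> y; rewrite /supp /= mulf_eq0 negb_or => /andP[]. Qed.

Lemma convolutionE f g x A : finite_set A -> meet_at (supp f) (supp g) x `<=` A ->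
  convolution f g x = \sum_(y <- fset_set A) f y * g (x - y).
Proof. by move=> fA sA; apply: fsbig_over => //; apply: subset_trans sA; apply: supp_mul. Qed.

Definition sumset (A B : set R) : set R := [set x + y | x in A & y in B].

Lemma supp_convolution f g : supp (convolution f g) `<=` sumset (supp f) (supp g).
Proof.
move=> x; apply: contraPP => nx; apply/negP; rewrite negbK; apply/eqP.
apply: fsbig1 => y _; apply: (@suppPn (fun y => f y * g (x - y))) => /supp_mul[fy gy]; apply: nx.
by exists y => //; exists (x - y) => //; rewrite addrC subrK.
Qed.

Lemma convolution_supported (a b : fsum) : convolution a b \in supported_in.
Proof.
apply/asboolP; apply: supportsS (supportsD (coef_supp a) (coef_supp b)).
exact: supp_convolution.
Qed.

Fact one_supported : (fun x : R => (x == 0)%:R : K) \in supported_in.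
Proof.
apply/asboolP; apply: supportsS (supports1 S) => x; rewrite /supp /=.
by case: (x =P 0) => // _; rewrite eqxx.
Qed.

Definition fsum_one : fsum := FSum one_supported.
Definition fsum_mul (a b : fsum) : fsum := FSum (convolution_supported a b).

Fact fsum_mulC : commutative fsum_mul.
Proof.
move=> a b; apply/fsumP => x /=; rewrite /convolution.
rewrite (@reindex_fsbigT _ _ _ _ _ (fun y => x - y)); last first.
  by exists (fun y => x - y) => y; rewrite subKr.
by apply: eq_fsbigr => y _; rewrite mulrC subKr.
Qed.

Fact fsum_mulA : associative fsum_mul.
Proof.
move=> a b c; apply/fsumP => x /=.
have Sa := coef_supp a; have Sb := coef_supp b; have Sc := coef_supp c.
pose Z := meet_at (supp a) (sumset (supp b) (supp c)) x.
pose Y := meet_at (sumset (supp a) (supp b)) (supp c) x.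
have fZ : finite_set Z by apply: supports_fin Sa (supportsD Sb Sc).
have fY : finite_set Y by apply: supports_fin (supportsD Sa Sb) Sc.
rewrite (convolutionE (A := Z))//; last first.
  by move=> y [ay bcy]; split=> //; apply: supp_convolution.
rewrite [RHS](convolutionE (A := Y))//; last first.
  by move=> y [aby cy]; split=> //; apply: supp_convolution.
transitivity (\sum_(z <- fset_set Z) \sum_(y <- fset_set Y)
    a z * (b (y - z) * c (x - y))).
  apply: eq_big_seq => z; rewrite in_fset_set// inE => -[az _].
  rewrite -big_distrr /=; congr (_ * _); rewrite /convolution.
  rewrite (@reindex_fsbigT _ _ _ _ _ (fun y => y - z)); last first.
    by exists (fun y => y + z) => y; rewrite ?subrK ?addrK.
  have E y : x - z - (y - z) = x - y by rewrite opprB addrA subrK.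
  under eq_fsbigr do rewrite E.
  apply: fsbig_over => // y; rewrite /supp /= mulf_eq0 negb_or => /andP[bz cy].
  by split=> //; exists z => //; exists (y - z) => //; rewrite addrC subrK.
rewrite exchange_big /=; apply: eq_big_seq => y.
rewrite in_fset_set// inE => -[_ cy].
rewrite (convolutionE (A := Z))//; last first.
  move=> z [az bz]; split=> //; exists (y - z) => //; exists (x - y) => //.
  by rewrite addrC subrKA.
by rewrite big_distrl; apply: eq_bigr => z _; rewrite mulrA.
Qed.

Fact fsum_mul1 : left_id fsum_one fsum_mul.
Proof.
move=> a; apply/fsumP => x /=.
rewrite (convolutionE (A := [set 0]))//; last first.
  by move=> y []; rewrite /supp /=; have [->|] := eqVneq y 0; rewrite ?eqxx.
by rewrite fset_set1 big_seq_fset1 /= eqxx mul1r subr0.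
Qed.

Fact fsum_mulDl : left_distributive fsum_mul (@GRing.add fsum).
Proof.
move=> a b c; apply/fsumP => x; rewrite coefD /=.
pose Y := meet_at (supp a) (supp c) x `|` meet_at (supp b) (supp c) x.
have fY : finite_set Y.
  by rewrite finite_setU; split; apply: supports_fin (coef_supp _) (coef_supp _).
rewrite !(convolutionE (A := Y))//.
- by rewrite -big_split; apply: eq_bigr => y _ /=; rewrite -mulrDl.
- by move=> y; right.
- by move=> y; left.
- move=> y [aby cy]; apply: contrapT => nY; move: aby; apply/negP; rewrite negbK.
  rewrite -[_ y]/(a y + b y) (@suppPn a) ?(@suppPn b) ?addr0// => h; apply: nY.
    by right.
  by left.
Qed.

Fact fsum_one_neq0 : fsum_one != 0.
Proof. by apply/eqP => /fsumP/(_ 0); rewrite coef0 /= eqxx => /eqP; rewrite oner_eq0. Qed.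

HB.instance Definition _ := GRing.Zmodule_isComNzRing.Build fsum
  fsum_mulA fsum_mulC fsum_mul1 fsum_mulDl fsum_one_neq0.

Lemma coef1 x : (1 : fsum) x = (x == 0)%:R. Proof. by []. Qed.
Lemma coefM (a b : fsum) x : (a * b : fsum) x = convolution a b x. Proof. by []. Qed.

(* Inverses are chosen classically. *)
Definition fsum_unit : {pred fsum} := fun a => `[< exists b : fsum, b * a = 1 >].
Definition fsum_inv (a : fsum) : fsum :=
  if pselect (exists b : fsum, b * a = 1) is left ex then projT1 (cid ex) else a.

Fact fsum_mulV : {in fsum_unit, left_inverse 1 fsum_inv *%R}.
Proof.
by move=> a /asboolP ua; rewrite /fsum_inv; case: pselect => // ex; case: cid.
Qed.

Fact fsum_unitP (a b : fsum) : b * a = 1 -> a \in fsum_unit.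
Proof. by move=> ba; apply/asboolP; exists b. Qed.

Fact fsum_invN : {in [predC fsum_unit], fsum_inv =1 id}.
Proof.
by move=> a /negP na; rewrite /fsum_inv; case: pselect => // ex; case: na; apply/asboolP.
Qed.

HB.instance Definition _ := GRing.ComNzRing_hasMulInverse.Build fsum
  fsum_mulV fsum_unitP fsum_invN.

End FormalSums.

Section Inclusion.
Variables (R : realType) (K : fieldType) (S T : supports R).
Hypothesis ST : forall A, S A -> T A.

Fact fsum_incl_supported (a : fsum K S) : (a : R -> K) \in supported_in T.
Proof. by apply/asboolP/ST/coef_supp. Qed.

Definition fsum_incl (a : fsum K S) : fsum K T := FSum (fsum_incl_supported a).

Fact fsum_incl_zmod_morphism : zmod_morphism fsum_incl.
Proof. by move=> a b; apply/fsumP. Qed.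
Fact fsum_incl_monoid_morphism : monoid_morphism fsum_incl.
Proof. by split=> [|a b]; apply/fsumP. Qed.

Lemma fsum_incl_inj : injective fsum_incl.
Proof. by move=> a b /fsumP ab; apply/fsumP. Qed.
End Inclusion.

Section Novikov.
Variables (R : realType) (G : zmodClosed R).
Implicit Types (A B : set R) (C : R).

Definition fin_supp A := A `<=` [set` G] /\ finite_set A.
Definition up_supp A :=
  A `<=` [set` G] /\ forall C, finite_set (A `&` [set g | g < C]).
Definition down_supp A :=
  A `<=` [set` G] /\ forall C, finite_set (A `&` [set g | - C < g]).

(* Common generalization of [up_supp] ([u = id]) and [down_supp] ([u = -%R]). *)
Section HalfLine.
Variable u : {additive R -> R}.

Definition half_supp A :=
  A `<=` [set` G] /\ forall C, finite_set (A `&` [set g | u g < C]).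

Lemma seq_minimum (z : R) (s : seq R) : z \in s ->
  exists2 g0, g0 \in s & forall g, g \in s -> u g0 <= u g.
Proof.
elim: s z => // y [|t s] IH z _.
  by exists y; rewrite ?mem_head// => g; rewrite inE => /eqP ->.
have [g0 g0s g0min] := IH t (mem_head _ _).
have [le|lt] := leP (u g0) (u y).
  by exists g0; rewrite 1?inE ?g0s ?orbT// => g; rewrite inE => /orP[/eqP->//|/g0min].
exists y; rewrite ?mem_head// => g; rewrite inE => /orP[/eqP->//|/g0min].
exact/le_trans/ltW.
Qed.

Lemma half_supp_min A : half_supp A -> A !=set0 ->
  exists2 g0, A g0 & forall g, A g -> u g0 <= u g.
Proof.
move=> [_ finA] [x0 Ax0].
have [s sE] : exists s : seq R, A `&` [set g | u g < u x0 + 1] = [set` s].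
  exact/finite_seqP/finA.
have x0s : x0 \in s.
  by have : [set` s] x0 by rewrite -sE; split=> //=; rewrite ltrDl.
have [g0 g0s g0min] := seq_minimum x0s.
have [Ag0 _] : (A `&` [set g | u g < u x0 + 1]) g0 by rewrite sE.
exists g0 => // g Ag; have [lt|ge] := ltP (u g) (u x0 + 1).
  by apply: g0min; have : [set` s] g by rewrite -sE.
by apply: le_trans ge; apply: le_trans (g0min _ x0s) _; rewrite lerDl.
Qed.

Lemma half_supp_lb A : half_supp A -> exists m, forall g, A g -> m <= u g.
Proof.
move=> hA; have [->|/set0P] := eqVneq A set0; first by exists 0.
by move=> /(half_supp_min hA)[g0 _ g0min]; exists (u g0).
Qed.

Fact half_supp1 : half_supp [set 0].
Proof.
split=> [x -> /=|C]; first exact: rpred0.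
by apply: sub_finite_set (finite_set1 0) => x [].
Qed.

Fact half_suppS A B : A `<=` B -> half_supp B -> half_supp A.
Proof.
move=> AB [BG fB]; split; first exact: subset_trans BG.
by move=> C; apply: sub_finite_set (fB C) => x [/AB].
Qed.

Fact half_suppU A B : half_supp A -> half_supp B -> half_supp (A `|` B).
Proof.
move=> [AG fA] [BG fB]; split; first by move=> x [/AG|/BG].
by move=> C; rewrite setIUl finite_setU.
Qed.

Fact half_suppD A B : half_supp A -> half_supp B ->
  half_supp [set x + y | x in A & y in B].
Proof.
move=> hA hB; have [[AG fA] [BG fB]] := (hA, hB); split.
  by move=> _ [x /AG /= Gx] [y /BG /= Gy] <-; rewrite /= rpredD.
move=> C; have [a ha] := half_supp_lb hA; have [b hb] := half_supp_lb hB.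
apply: sub_finite_set (finite_image2 +%R (fA (C - b)) (fB (C - a))).
move=> _ [[x Ax] [y By] <-] /=; rewrite raddfD /= => lt.
exists x; last exists y => //.
  by split=> //=; rewrite ltrBrDr; apply: le_lt_trans lt; rewrite lerD2l hb.
by split=> //=; rewrite ltrBrDl; apply: le_lt_trans lt; rewrite lerD2r ha.
Qed.

Fact half_supp_fin A B x : half_supp A -> half_supp B ->
  finite_set (A `&` [set y | B (x - y)]).
Proof.
move=> [_ fA] hB; have [b hb] := half_supp_lb hB.
apply: sub_finite_set (fA (u x - b + 1)) => y [Ay /= /hb]; rewrite raddfB => le.
by split=> //=; rewrite ltr_pwDr// lerBrDr -lerBrDl.
Qed.
End HalfLine.
End Novikov.

Section Units.
Variables (R : realType) (K : fieldType) (G : zmodClosed R).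
Variables (S : supports R) (u : {additive R -> R}).
Hypotheses (u_inj : injective u) (SE : forall A, S A <-> half_supp G u A).
Implicit Types (a b w : fsum K S).

Definition from_level a e := forall x, supp a x -> e <= u x.

Lemma from_levelM a b p q :
  from_level a p -> from_level b q -> from_level (a * b) (p + q).
Proof.
move=> ap bq x /supp_convolution[y ay [z bz <-]].
by rewrite raddfD lerD ?ap ?bq.
Qed.

Lemma from_level1 : from_level 1 0.
Proof.
move=> x; rewrite /supp /= ; have [->|] := eqVneq x 0; rewrite ?eqxx//.
by rewrite raddf0.
Qed.

Lemma from_levelX a e n : from_level a e -> from_level (a ^+ n) (e *+ n).
Proof.
move=> ae; elim: n => [|n IH]; first by rewrite expr0 mulr0n; exact: from_level1.
by rewrite exprS mulrS; apply: from_levelM.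
Qed.

Arguments from_levelX {a e} n _.

Lemma from_level_coef a e x : from_level a e -> u x < e -> a x = 0.
Proof.
by move=> ae lt; apply: suppPn => /ae; rewrite leNgt lt.
Qed.

Lemma unit_1Bw w e : 0 < e -> from_level w e -> 1 - w \is a GRing.unit.
Proof.
move=> e0 we.
pose P n : fsum K S := \sum_(i < n) w ^+ i.
have PS n m x : u x < e *+ n -> P (n + m)%N x = P n x.
  move=> lt; elim: m => [|m IH]; first by rewrite addn0.
  rewrite addnS /P big_ord_recr coefD IH (from_level_coef (from_levelX _ we)).
    by rewrite addr0.
  by apply: lt_le_trans lt _; rewrite ler_wpMn2l ?leq_addr// ltW.
have PE n m x : u x < e *+ n -> u x < e *+ m -> P n x = P m x.
  by move=> hn hm; rewrite -(PS n m x hn) addnC PS.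
have arch C : {n | C < e *+ n}.
  exists (Num.bound (`|C| / e)); apply: le_lt_trans (ler_norm C) _.
  have := archi_boundP (divr_ge0 (normr_ge0 C) (ltW e0)).
  by rewrite ltr_pdivrMr// mulr_natl.
pose N C := projT1 (arch C); have NP C : C < e *+ N C by exact: projT2 (arch C).
pose b x : K := P (N (u x)) x.
have Sb : b \in supported_in S.
  apply/asboolP/SE; split=> [x bx|C].
    by have /SE[+ _] := coef_supp (P (N (u x))); apply.
  have /SE[_ /(_ C)] := coef_supp (P (N C)); apply: sub_finite_set.
  move=> x [bx lt]; split=> //; rewrite /supp /= (PE _ (N (u x)))//.
  exact: lt_trans (NP C).
apply: (@fsum_unitP _ _ _ _ (FSum Sb)); apply/fsumP => x.
pose n := N (u x); pose r : fsum K S := FSum Sb - P n.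
have rn : from_level r (e *+ n).
  move=> y; apply: contraPP => /negP; rewrite -ltNge => lt.
  by apply/negP; rewrite negbK coefD coefN /= /b (PE (N (u y)) n)// subrr.
have -> : FSum Sb = P n + r by rewrite addrC subrK.
rewrite mulrDl coefD (from_level_coef (e := e *+ n) (a := r * _)) ?addr0//; last first.
  rewrite -[e *+ n]addr0; apply: from_levelM => // y.
  have [-> _|yn0] := eqVneq y 0; first by rewrite raddf0.
  rewrite suppE coefD coefN coef1 (negbTE yn0) add0r oppr_eq0 => wy.
  exact/ltW/(lt_le_trans e0)/we.
have -> : P n * (1 - w) = 1 - w ^+ n.
  by rewrite -[in RHS](expr1n _ n) subrXX mulrC; congr (_ * _);
    apply: eq_bigr => i _; rewrite expr1n mul1r.
by rewrite coefD coefN (from_level_coef (from_levelX n we))// subr0.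
Qed.

Definition monomial_fun (c : K) (g : R) : R -> K := fun x => if x == g then c else 0.

Lemma monomial_supported c g : g \in G -> monomial_fun c g \in supported_in S.
Proof.
move=> Gg; apply/asboolP/SE; apply: (@half_suppS _ _ _ _ [set g]).
  by move=> x; rewrite suppE /monomial_fun; case: (x =P g); rewrite ?eqxx.
split=> [x -> //|C]; by apply: sub_finite_set (finite_set1 g) => x [].
Qed.

Lemma coef_mul_monomial a c g (Gg : g \in G) x :
  (a * FSum (monomial_supported c Gg)) x = a (x - g) * c.
Proof.
rewrite coefM (convolutionE (A := [set x - g]))//.
  by rewrite fset_set1 big_seq_fset1 /= /monomial_fun subKr eqxx.
move=> y [_]; rewrite /= suppE /monomial_fun.
by case: (_ =P g) => [<- _|]; rewrite ?eqxx// subKr.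
Qed.

Lemma novikov_unit a : a != 0 -> a \is a GRing.unit.
Proof.
move=> a0; have ha : half_supp G u (supp a) by apply/SE/coef_supp.
have [g0 ag0 g0min] : exists2 g0, supp a g0 & forall g, supp a g -> u g0 <= u g.
  exact: half_supp_min ha (supp_neq0 a0).
have Gg0 : - g0 \in G by rewrite rpredN; exact: ha.1.
pose m := FSum (monomial_supported (a g0)^-1 Gg0).
suff : a * m \is a GRing.unit by rewrite unitrM => /andP[].
pose w := 1 - a * m; have -> : a * m = 1 - w by rewrite subKr.
have wpos x : supp w x -> 0 < u x.
  rewrite suppE coefD coefN coef1 coef_mul_monomial opprK.
  have [->|x0] := eqVneq x 0; first by rewrite add0r mulfV// subrr eqxx.
  rewrite add0r oppr_eq0 mulf_eq0 negb_or => /andP[/g0min].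
  rewrite raddfD lerDr => ux _; rewrite lt_neqAle ux andbT eq_sym.
  by rewrite -(raddf0 u) (inj_eq u_inj).
have [w0|/set0P ne] := eqVneq (supp w) set0.
  by apply: (@unit_1Bw _ 1) => // x; rewrite w0.
have [h wh hmin] := half_supp_min ((SE _).1 (coef_supp w)) ne.
by apply: (@unit_1Bw _ (u h)) => //; exact: wpos.
Qed.
End Units.

Section NovikovFields.
Variables (R : realType) (K : fieldType) (G : zmodClosed R).

Lemma up_half_supp A : up_supp G A <-> half_supp G idfun A.
Proof. by []. Qed.

Lemma down_half_supp A : down_supp G A <-> half_supp G -%R A.
Proof.
have E C : [set g : R | - C < g] = [set g | - g < C].
  by apply/funext => g /=; rewrite ltrNl.
by rewrite /down_supp /half_supp; split=> -[AG fA]; split=> // C;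
  have := fA C; rewrite E.
Qed.

Definition up_supports : supports R :=
  @Supports R (up_supp G) (half_supp1 G idfun) (@half_suppS _ G idfun)
    (@half_suppU _ G idfun) (@half_suppD _ G idfun) (@half_supp_fin _ G idfun).

Fact down_supp1 : down_supp G [set 0].
Proof. exact/down_half_supp/half_supp1. Qed.

Fact down_suppS A B : A `<=` B -> down_supp G B -> down_supp G A.
Proof.
by move=> AB /down_half_supp hB; apply/down_half_supp; apply: half_suppS hB.
Qed.

Fact down_suppU A B : down_supp G A -> down_supp G B -> down_supp G (A `|` B).
Proof.
move=> /down_half_supp hA /down_half_supp hB; apply/down_half_supp.
exact: half_suppU.
Qed.

Fact down_suppD A B : down_supp G A -> down_supp G B ->
  down_supp G [set x + y | x in A & y in B].
Proof.
move=> /down_half_supp hA /down_half_supp hB; apply/down_half_supp.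
exact: half_suppD.
Qed.

Fact down_supp_fin A B x : down_supp G A -> down_supp G B ->
  finite_set (A `&` [set y | B (x - y)]).
Proof.
move=> /down_half_supp hA /down_half_supp hB.
exact: half_supp_fin hA hB.
Qed.

Definition down_supports : supports R :=
  Supports down_supp1 down_suppS down_suppU down_suppD down_supp_fin.

Fact fin_supp1 : fin_supp G [set 0].
Proof. by split=> [x -> /=|//]; exact: rpred0. Qed.

Fact fin_suppS A B : A `<=` B -> fin_supp G B -> fin_supp G A.
Proof. by move=> AB [BG fB]; split; [exact: subset_trans BG|exact: sub_finite_set fB]. Qed.

Fact fin_suppU A B : fin_supp G A -> fin_supp G B -> fin_supp G (A `|` B).
Proof. by move=> [AG fA] [BG fB]; rewrite /fin_supp subUset finite_setU. Qed.

Fact fin_suppD A B : fin_supp G A -> fin_supp G B ->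
  fin_supp G [set x + y | x in A & y in B].
Proof.
move=> [AG fA] [BG fB]; split; last exact: finite_image2.
by move=> _ [x /AG /= Gx] [y /BG /= Gy] <-; rewrite /= rpredD.
Qed.

Fact fin_supp_fin A B x : fin_supp G A -> fin_supp G B ->
  finite_set (A `&` [set y | B (x - y)]).
Proof. by move=> [_ fA] _; exact: finite_setIl. Qed.

Definition fin_supports : supports R :=
  Supports fin_supp1 fin_suppS fin_suppU fin_suppD fin_supp_fin.

Definition group_algebra := fsum K fin_supports.
HB.instance Definition _ := GRing.ComUnitRing.on group_algebra.

Definition novikov_up := fsum K up_supports.
HB.instance Definition _ := GRing.ComUnitRing.on novikov_up.

Definition novikov_down := fsum K down_supports.
HB.instance Definition _ := GRing.ComUnitRing.on novikov_down.

Fact novikov_up_unit (a : novikov_up) : a != 0 -> a \is a GRing.unit.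
Proof. exact: (@novikov_unit _ K G up_supports idfun (fun x y => id) up_half_supp a). Qed.
HB.instance Definition _ :=
  GRing.ComUnitRing_isField.Build novikov_up novikov_up_unit.

Fact novikov_down_unit (a : novikov_down) : a != 0 -> a \is a GRing.unit.
Proof. exact: (@novikov_unit _ K G down_supports -%R oppr_inj down_half_supp a). Qed.
HB.instance Definition _ :=
  GRing.ComUnitRing_isField.Build novikov_down novikov_down_unit.

Fact fin_up A : fin_supports A -> up_supports A.
Proof. by move=> [AG fA]; split=> // C; exact: finite_setIl. Qed.

Fact fin_down A : fin_supports A -> down_supports A.
Proof. by move=> [AG fA]; split=> // C; exact: finite_setIl. Qed.

Definition incl_up : group_algebra -> novikov_up := fsum_incl fin_up.
Definition incl_down : group_algebra -> novikov_down := fsum_incl fin_down.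

HB.instance Definition _ := GRing.isZmodMorphism.Build group_algebra novikov_up
  incl_up (fsum_incl_zmod_morphism fin_up).
HB.instance Definition _ := GRing.isMonoidMorphism.Build group_algebra novikov_up
  incl_up (fsum_incl_monoid_morphism K fin_up).
HB.instance Definition _ := GRing.isZmodMorphism.Build group_algebra novikov_down
  incl_down (fsum_incl_zmod_morphism fin_down).
HB.instance Definition _ := GRing.isMonoidMorphism.Build group_algebra novikov_down
  incl_down (fsum_incl_monoid_morphism K fin_down).

Fact group_algebra_domain : GRing.integral_domain_axiom group_algebra.
Proof.
move=> a b ab0.
have incl0 c : incl_up c = 0 -> c == 0.
  by move=> /fsumP c0; apply/eqP/fsumP => x; exact: c0 x.
have : incl_up a * incl_up b == 0 by rewrite -rmorphM ab0 rmorph0.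
by rewrite mulf_eq0 => /orP[] /eqP/incl0 ->; rewrite ?orbT.
Qed.
HB.instance Definition _ :=
  GRing.ComUnitRing_isIntegral.Build group_algebra group_algebra_domain.

Local Open Scope ereal_scope.

(* The infimum is a minimum for a nonzero sum, and it is [+oo] for 0; see
   [nu_up_min] and [nu_up0]. Dually for [nu_down]. *)
Definition nu_up (a : novikov_up) : \bar R := ereal_inf (EFin @` supp a).
Definition nu_down (a : novikov_down) : \bar R := ereal_sup (EFin @` supp a).


Lemma nu_up0 : nu_up 0%R = +oo.
Proof.
rewrite /nu_up (_ : supp _ = set0) ?image_set0 ?ereal_inf0//.
by apply/seteqP; split=> // x; rewrite suppE eqxx.
Qed.

Lemma nu_down0 : nu_down 0%R = -oo.
Proof.
rewrite /nu_down (_ : supp _ = set0) ?image_set0 ?ereal_sup0//.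
by apply/seteqP; split=> // x; rewrite suppE eqxx.
Qed.

Lemma nu_up_min (a : novikov_up) : a != 0%R ->
  exists2 g, supp a g & nu_up a = g%:E /\ forall h, supp a h -> (g <= h)%R.
Proof.
move=> /supp_neq0 a0.
have [g ag gmin] := half_supp_min ((up_half_supp _).1 (coef_supp a)) a0.
exists g => //; split=> //; apply/eqP; rewrite eq_le; apply/andP; split.
  by apply: ereal_inf_lbound; exists g.
by apply: le_ereal_inf_tmp => _ [h ah <-]; rewrite lee_fin gmin.
Qed.

Lemma nu_down_max (a : novikov_down) : a != 0%R ->
  exists2 g, supp a g & nu_down a = g%:E /\ forall h, supp a h -> (h <= g)%R.
Proof.
move=> /supp_neq0 a0.
have [g ag gmin] := half_supp_min ((down_half_supp _).1 (coef_supp a)) a0.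
have gmax h : supp a h -> (h <= g)%R by move=> /gmin; rewrite lerN2.
exists g => //; split=> //; apply/eqP; rewrite eq_le; apply/andP; split.
  by apply: ge_ereal_sup => _ [h ah <-]; rewrite lee_fin gmax.
by apply: ereal_sup_ubound; exists g.
Qed.
End NovikovFields.

Section ExtensionOfScalars.
Variables (A B : comNzRingType) (i : {rmorphism A -> B}) (H : lmodType A).

(* The tensor product of B and H over A: a list of pairs [(b, x)] stands for the
   finite sum of the [b (x) x], and lists are identified by the smallest
   additive congruence that makes [(x)] biadditive and A-balanced. *)
Inductive tensor_rel : seq (B * H) -> seq (B * H) -> Prop :=
| tensor_refl s : tensor_rel s s
| tensor_sym s t : tensor_rel s t -> tensor_rel t s
| tensor_trans t s r : tensor_rel s t -> tensor_rel t r -> tensor_rel s r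
| tensor_cat s s' t t' :
    tensor_rel s s' -> tensor_rel t t' -> tensor_rel (s ++ t) (s' ++ t')
| tensor_catC s t : tensor_rel (s ++ t) (t ++ s)
| tensor_Dl b c x : tensor_rel [:: (b + c, x)] [:: (b, x); (c, x)]
| tensor_Dr b x y : tensor_rel [:: (b, x + y)] [:: (b, x); (b, y)]
| tensor_balanced b a x : tensor_rel [:: (b * i a, x)] [:: (b, a *: x)]
| tensor_0l x : tensor_rel [:: (0, x)] [::].

Definition tensor_eqv (s t : seq (B * H)) : bool := `[< tensor_rel s t >].

Fact tensor_eqv_is_equiv : equiv_class_of tensor_eqv.
Proof.
split=> [s|s t|s t r].
- exact/asboolP/tensor_refl.
- by apply/asboolP/asboolP; exact: tensor_sym.
- by move=> /asboolP st /asboolP tr; apply/asboolP; apply: tensor_trans tr.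
Qed.
Canonical tensor_equiv := EquivRelPack tensor_eqv_is_equiv.
Canonical tensor_encModRel := defaultEncModRel tensor_eqv.

Definition tensor : Type := {eq_quot tensor_eqv}.
HB.instance Definition _ := EqQuotient.on tensor.
HB.instance Definition _ := Choice.on tensor.

Local Notation cls := (\pi_tensor).

Lemma tensorP s t : cls s = cls t <-> tensor_rel s t.
Proof.
split=> [/eqP|st]; first by rewrite piE => /asboolP.
by apply/eqP; rewrite piE; apply/asboolP.
Qed.

Lemma repr_tensor s : tensor_rel (repr (cls s)) s.
Proof. by apply/tensorP; rewrite reprK. Qed.

Definition tensor_add (t t' : tensor) : tensor := cls (repr t ++ repr t').
Definition tensor_zero : tensor := cls [::].
Definition scale_seq (c : B) (s : seq (B * H)) := [seq (c * p.1, p.2) | p <- s].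
Definition tensor_scale c (t : tensor) : tensor := cls (scale_seq c (repr t)).
Definition tensor_opp := tensor_scale (-1).

Lemma tensor_addE s t : tensor_add (cls s) (cls t) = cls (s ++ t).
Proof. by apply/tensorP/tensor_cat; apply: repr_tensor. Qed.

Lemma scale_seq_rel c s t : tensor_rel s t -> tensor_rel (scale_seq c s) (scale_seq c t).
Proof.
elim=> {s t} [s|s t _|t s r _ + _|s s' t t' _ IHs _ IHt|s t|b d x|b x y|b a x|x].
- exact: tensor_refl.
- exact: tensor_sym.
- exact: tensor_trans.
- by rewrite /scale_seq !map_cat; apply: tensor_cat.
- by rewrite /scale_seq !map_cat; apply: tensor_catC.
- by rewrite /= mulrDr; apply: tensor_Dl.
- exact: tensor_Dr.
- by rewrite /= mulrA; apply: tensor_balanced.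
- by rewrite /= mulr0; apply: tensor_0l.
Qed.

Lemma tensor_scaleE c s : tensor_scale c (cls s) = cls (scale_seq c s).
Proof. by apply/tensorP/scale_seq_rel/repr_tensor. Qed.

Lemma tensor_ind (P : tensor -> Prop) : (forall s, P (cls s)) -> forall t, P t.
Proof. by move=> Ps t; rewrite -[t]reprK; apply: Ps. Qed.

Fact tensor_addA : associative tensor_add.
Proof.
by elim/tensor_ind=> s; elim/tensor_ind=> t; elim/tensor_ind=> r; rewrite !tensor_addE catA.
Qed.

Fact tensor_addC : commutative tensor_add.
Proof.
elim/tensor_ind=> s; elim/tensor_ind=> t; rewrite !tensor_addE.
exact/tensorP/tensor_catC.
Qed.

Fact tensor_add0 : left_id tensor_zero tensor_add.
Proof. by elim/tensor_ind=> s; rewrite tensor_addE. Qed.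

Lemma scale_seqDl c d s :
  tensor_rel (scale_seq (c + d) s) (scale_seq c s ++ scale_seq d s).
Proof.
elim: s => [|[b x] s IH]; first exact: tensor_refl.
rewrite /= mulrDl -cat1s.
apply: (tensor_trans (tensor_cat (tensor_Dl _ _ _) IH)); rewrite /=.
rewrite -(cat1s (c * b, x) (_ :: _)) -(cat1s (c * b, x) (_ ++ _)).
apply: tensor_cat (tensor_refl _) _.
rewrite -cat1s catA -(cat1s (d * b, x) (scale_seq _ _)) catA.
by apply: tensor_cat (tensor_refl _); apply: tensor_catC.
Qed.

Lemma scale_seq0 s : tensor_rel (scale_seq 0 s) [::].
Proof.
elim: s => [|[b x] s IH]; first exact: tensor_refl.
rewrite /= mul0r -cat1s -[[::]]/([::] ++ [::]).
exact: tensor_cat (tensor_0l _) IH.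
Qed.

Lemma scale_seq1 s : scale_seq 1 s = s.
Proof. by rewrite -[RHS]map_id; apply: eq_map => -[b x]; rewrite /= mul1r. Qed.

Fact tensor_addN : left_inverse tensor_zero tensor_opp tensor_add.
Proof.
elim/tensor_ind=> s; rewrite /tensor_opp tensor_scaleE tensor_addE.
apply/tensorP; apply: tensor_trans (scale_seq0 s).
rewrite -[X in _ ++ X]scale_seq1 -[0](addNr 1).
exact/tensor_sym/scale_seqDl.
Qed.

HB.instance Definition _ := GRing.isZmodule.Build tensor
  tensor_addA tensor_addC tensor_add0 tensor_addN.

Fact tensor_scaleA c d t : tensor_scale c (tensor_scale d t) = tensor_scale (c * d) t.
Proof.
elim/tensor_ind: t => s; rewrite !tensor_scaleE /scale_seq -map_comp.
by congr cls; apply: eq_map => p; rewrite /= mulrA.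
Qed.

Fact tensor_scale1 : left_id 1 tensor_scale.
Proof. by elim/tensor_ind=> s; rewrite tensor_scaleE scale_seq1. Qed.

Fact tensor_scaleDr : right_distributive tensor_scale +%R.
Proof.
move=> c; elim/tensor_ind=> s; elim/tensor_ind=> t.
rewrite [in LHS]/+%R /= !tensor_addE !tensor_scaleE [in RHS]/+%R /= tensor_addE.
by rewrite /scale_seq map_cat.
Qed.

Fact tensor_scaleDl t : {morph tensor_scale^~ t : c d / c + d}.
Proof.
move=> c d; elim/tensor_ind: t => s; rewrite !tensor_scaleE.
by rewrite [in RHS]/+%R /= tensor_addE; apply/tensorP/scale_seqDl.
Qed.

HB.instance Definition _ := GRing.Zmodule_isLmodule.Build B tensor
  tensor_scaleA tensor_scale1 tensor_scaleDr tensor_scaleDl.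

Definition pure_tensor (b : B) (x : H) : tensor := cls [:: (b, x)].

(* For [phi : H -> V] linear over [A], this is the [B]-linear map
   [1 (x) phi] sending [b (x) x] to [b *: phi x]. *)
Section Lift.
Variables (V : lmodType B) (phi : {linear H -> V | i \; *:%R}).

Definition sum_seq (s : seq (B * H)) : V := \sum_(p <- s) p.1 *: phi p.2.

Lemma sum_seq_rel s t : tensor_rel s t -> sum_seq s = sum_seq t.
Proof.
elim=> {s t} [//|s t _ ->//|t s r _ -> _ ->//|s s' t t' _ IHs _ IHt|s t|b d x|b x y|b a x|x];
  rewrite /sum_seq ?big_cat ?big_cons ?big_nil ?addr0 /=.
- by rewrite -/(sum_seq _) IHs -/(sum_seq t) IHt.
- by rewrite addrC.
- by rewrite scalerDl.
- by rewrite linearD scalerDr.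
- by rewrite linearZ /= scalerA.
- by rewrite scale0r.
Qed.

Definition tensor_lift (t : tensor) : V := sum_seq (repr t).

Lemma tensor_lift_cls s : tensor_lift (cls s) = sum_seq s.
Proof. exact/sum_seq_rel/repr_tensor. Qed.

Lemma tensor_lift_pure b x : tensor_lift (pure_tensor b x) = b *: phi x.
Proof. by rewrite tensor_lift_cls /sum_seq big_cons big_nil addr0. Qed.

Fact tensor_lift_linear : linear tensor_lift.
Proof.
move=> c; elim/tensor_ind=> s; elim/tensor_ind=> t.
rewrite [_ *: _]tensor_scaleE [_ + _]tensor_addE !tensor_lift_cls.
rewrite /sum_seq big_cat big_map /= scaler_sumr; congr (_ + _).
by apply: eq_bigr => p _; rewrite scalerA.
Qed.
HB.instance Definition _ :=
  GRing.isLinear.Build B tensor V *:%R tensor_lift tensor_lift_linear.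
End Lift.
End ExtensionOfScalars.

Section Modules.
Variables (A : idomainType) (H : lmodType A).

Definition torsion : {pred H} :=
  fun x => `[< exists2 a : A, a != 0 & a *: x = 0 >].

Lemma torsionP x : reflect (exists2 a : A, a != 0 & a *: x = 0) (x \in torsion).
Proof. exact: asboolP. Qed.

Fact torsion_zmod_closed : zmod_closed torsion.
Proof.
split=> [|x y /torsionP[a a0 ax] /torsionP[b b0 by0]]; apply/torsionP.
  by exists 1; rewrite ?oner_eq0 ?scaler0.
exists (a * b); first by rewrite mulf_neq0.
by rewrite scalerBr {1}mulrC -!scalerA ax by0 !scaler0 subrr.
Qed.
HB.instance Definition _ := GRing.isZmodClosed.Build H torsion torsion_zmod_closed.

Lemma torsionZ a x : x \in torsion -> a *: x \in torsion.
Proof.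
move=> /torsionP[b b0 bx]; apply/torsionP; exists b => //.
by rewrite scalerA mulrC -scalerA bx scaler0.
Qed.

Definition mod_torsion : Type := Quotient.quot torsion.
HB.instance Definition _ := GRing.Zmodule.on mod_torsion.
HB.instance Definition _ := EqQuotient.on mod_torsion.

Definition proj_torsion (x : H) : mod_torsion := \pi_mod_torsion x.

Lemma proj_torsionP x y : proj_torsion x = proj_torsion y <-> x - y \in torsion.
Proof. by rewrite Quotient.idealrBE; split=> /eqP. Qed.

Definition mod_torsion_scale (a : A) (q : mod_torsion) : mod_torsion :=
  proj_torsion (a *: repr q).

Fact proj_torsionB x y : proj_torsion (x - y) = proj_torsion x - proj_torsion y.
Proof. by rewrite /proj_torsion !piE. Qed.

Fact proj_torsionD x y : proj_torsion (x + y) = proj_torsion x + proj_torsion y.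
Proof. by rewrite /proj_torsion !piE. Qed.

Lemma mod_torsion_scaleE a x :
  mod_torsion_scale a (proj_torsion x) = proj_torsion (a *: x).
Proof.
apply/proj_torsionP; rewrite -scalerBr; apply/torsionZ/proj_torsionP.
exact: reprK.
Qed.

Lemma mod_torsion_ind (P : mod_torsion -> Prop) :
  (forall x, P (proj_torsion x)) -> forall q, P q.
Proof. by move=> Px q; rewrite -[q]reprK; apply: Px. Qed.

Fact mod_torsion_scaleA a b q :
  mod_torsion_scale a (mod_torsion_scale b q) = mod_torsion_scale (a * b) q.
Proof. by elim/mod_torsion_ind: q => x; rewrite !mod_torsion_scaleE scalerA. Qed.

Fact mod_torsion_scale1 : left_id 1 mod_torsion_scale.
Proof. by elim/mod_torsion_ind=> x; rewrite mod_torsion_scaleE scale1r. Qed.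

Fact mod_torsion_scaleDr : right_distributive mod_torsion_scale +%R.
Proof.
move=> a; elim/mod_torsion_ind=> x; elim/mod_torsion_ind=> y.
by rewrite -proj_torsionD !mod_torsion_scaleE scalerDr proj_torsionD.
Qed.

Fact mod_torsion_scaleDl q : {morph mod_torsion_scale^~ q : a b / a + b}.
Proof.
move=> a b; elim/mod_torsion_ind: q => x.
by rewrite !mod_torsion_scaleE scalerDl proj_torsionD.
Qed.

HB.instance Definition _ := GRing.Zmodule_isLmodule.Build A mod_torsion
  mod_torsion_scaleA mod_torsion_scale1 mod_torsion_scaleDr mod_torsion_scaleDl.

Fact proj_torsion_linear : linear proj_torsion.
Proof.
move=> a x y; rewrite proj_torsionD; congr (_ + _).
by rewrite -mod_torsion_scaleE.
Qed.
HB.instance Definition _ :=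
  GRing.isLinear.Build A H mod_torsion *:%R proj_torsion proj_torsion_linear.
End Modules.

Section Generation.
Variables (A : comNzRingType) (M : lmodType A).

Definition spanning n (s : n.-tuple M) : Prop :=
  forall x, exists c : 'I_n -> A, x = \sum_(i < n) c i *: tnth s i.

Definition independent n (s : n.-tuple M) : Prop :=
  forall c : 'I_n -> A, \sum_(i < n) c i *: tnth s i = 0 -> forall i, c i = 0.

Definition module_basis n (s : n.-tuple M) : Prop := independent s /\ spanning s.

Definition finitely_generated : Prop := exists n (s : n.-tuple M), spanning s.
End Generation.

Section Subgroups.
Variables (R : realType) (G : zmodClosed R).

Definition fin_gen_subgroup : Prop :=
  exists n (s : n.-tuple R), forall g, g \in G <-> inIntSpan s g.

Definition discrete_subgroup : Prop := [set` G] `<=` isolated [set` G].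
End Subgroups.

Section NormedSpaces.
Variables (R : realType) (K : fieldType) (G : zmodClosed R).
Local Open Scope ereal_scope.

Record norm_up (V : vectType (novikov_up K G)) := NormUp {
  rho_up :> V -> \bar R;
  rho_up_fin : forall x, rho_up x != +oo;
  rho_up_eqNy : forall x, rho_up x = -oo <-> x = 0%R;
  rho_upZ : forall (l : novikov_up K G) x,
    rho_up (l *: x)%R = rho_up x - nu_up l;
  rho_upD : forall x y, rho_up (x + y)%R <= maxe (rho_up x) (rho_up y) }.

Record norm_down (V : vectType (novikov_down K G)) := NormDown {
  rho_down :> V -> \bar R;
  rho_down_fin : forall x, rho_down x != -oo;
  rho_down_eqy : forall x, rho_down x = +oo <-> x = 0%R;
  rho_downZ : forall (l : novikov_down K G) x,
    rho_down (l *: x)%R = rho_down x - nu_down l;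
  rho_downD : forall x y, mine (rho_down x) (rho_down y) <= rho_down (x + y)%R }.

(* For the empty family the maximum (resp. minimum) is [-oo] (resp. [+oo]), the
   value of the norm at 0. *)
Definition orthogonal_up (V : vectType (novikov_up K G)) (rho : norm_up V)
    k (x : k.-tuple V) : Prop :=
  forall l : 'I_k -> novikov_up K G,
    rho (\sum_(i < k) l i *: tnth x i)%R =
    \big[maxe/-oo]_(i < k) (rho (tnth x i) - nu_up (l i)).

Definition orthogonal_down (V : vectType (novikov_down K G)) (rho : norm_down V)
    k (x : k.-tuple V) : Prop :=
  forall l : 'I_k -> novikov_down K G,
    rho (\sum_(i < k) l i *: tnth x i)%R =
    \big[mine/+oo]_(i < k) (rho (tnth x i) - nu_down (l i)).
End NormedSpaces.

(* [phi_up] and [phi_down] are linear over the group algebra, which acts on the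
   two target spaces through its inclusions into the Novikov fields. *)
Record filtered_matched_pair (R : realType) (K : fieldType) (G : zmodClosed R) :=
  FilteredMatchedPair {
    mp_module :> lmodType (group_algebra K G);
    mp_fin_gen : finitely_generated mp_module;
    V_up : vectType (novikov_up K G);
    norm_V_up : norm_up V_up;
    V_down : vectType (novikov_down K G);
    norm_V_down : norm_down V_down;
    phi_up : {linear mp_module -> V_up | @incl_up R K G \; *:%R};
    phi_down : {linear mp_module -> V_down | @incl_down R K G \; *:%R};
    phi_up_iso : bijective (tensor_lift phi_up);
    phi_down_iso : bijective (tensor_lift phi_down) }.

Definition doubly_orthogonal_basis (R : realType) (K : fieldType)
    (G : zmodClosed R) (P : filtered_matched_pair K G) d (e : d.-tuple P) : Prop :=
  [/\ module_basis (map_tuple (@proj_torsion _ P) e),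
      basis_of fullv (map_tuple (phi_up P) e)
        /\ orthogonal_up (norm_V_up P) (map_tuple (phi_up P) e)
    & basis_of fullv (map_tuple (phi_down P) e)
        /\ orthogonal_down (norm_V_down P) (map_tuple (phi_down P) e)].

(* Main.v *)
From HB Require Import structures.
Require Import Defs.
From mathcomp Require Import all_boot all_order all_algebra.
From mathcomp Require Import boolp classical_sets cardinality.
From mathcomp Require Import reals ereal topology normedtype lra.

(** Write [r1 = rho_up] and [r2 = - rho_down], so that both norms satisfy the
    ultrametric inequality with a maximum, and let [height x] be
    [r1 (phi_up x) + r2 (phi_down x)], a quantity that does not change when [x] is
    multiplied by a monomial. The basis is built greedily: [e_j] is an element of
    [H] of least height among those whose image in [V_up] is not in the span of the
    images of [e_i] for [i < j].

    Such elements exist ([minima_exist]). Each of the two Novikov fields is complete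
    with discrete value group, so [V_up] and [V_down] have orthogonal bases
    ([orthogonal_basis_exists]). It follows that the values of each norm lie in
    finitely many cosets of the group, and that coordinates are bounded functions;
    the latter, applied to a maximal independent family of [H], shows that the
    height is bounded below outside torsion ([height_bounded]). A set of reals that
    is bounded below and contained in finitely many cosets of a discrete group has a
    minimum ([coset_min]).

    The family is orthogonal for both norms ([minima_orthogonal]). If there were a
    cancellation in a combination of the [phi_up e_i], one could keep only the
    leading monomials [c_i T^(g_i)] of the coefficients of the terms of maximal norm
    [M]. The element [y] of [H] that is the sum of these [c_i T^(g_i) e_i] has
    [r1 < M] and [r2 <= height e_j - M], where [j] is the last index involved, so its
    height is less than that of [e_j] although [y] was a candidate for [e_j]. The
    argument is symmetric in the two norms.

    The family generates [H] modulo torsion ([minima_generate]). Some nonzero [a]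
    satisfies [a x = sum_i b_i e_i] for given [x]. Subtracting from [x] a combination
    of the [e_i] replaces each [b_i] by its remainder modulo [a], which can be
    chosen with support in any translate of the half-open hull of the support of [a]
    ([window_division_group_algebra]; this uses discreteness again). Translating it
    by [r1 (phi_up e_i)] makes the height of the result less than that of [e_j], for
    [j] the last index, so the remainder of [b_j] is zero, and [b_j] is divisible by
    [a].

    All comparisons between [H] and the vector spaces rest on the fact that
    independent elements of [H] have independent images ([indep_phi]), a consequence
    of the Novikov fields being torsion-free over the group algebra. *)

Set Implicit Arguments.
Unset Strict Implicit.
Unset Printing Implicit Defensive.

Import Order.TTheory GRing.Theory Num.Theory.
Import numFieldNormedType.Exports.

Local Open Scope ring_scope.

(** * Linear combinations of sequences *)

(** The combination of a sequence with coefficients indexed by [nat]; only the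
    coefficients of index smaller than [size s] matter. *)
Definition lincomb (A : nzRingType) (M : lmodType A) (s : seq M) (c : nat -> A) : M :=
  \sum_(j < size s) c j *: s`_j.

(** Linear independence over an arbitrary ring. *)
Definition lin_indep (A : nzRingType) (M : lmodType A) (s : seq M) : Prop :=
  forall c, lincomb s c = 0 -> forall j, (j < size s)%N -> c j = 0.

Section LinComb.
Variables (A : nzRingType) (M : lmodType A).
Implicit Types (s : seq M) (c : nat -> A).

Lemma eq_lincomb s c c' :
  (forall j, (j < size s)%N -> c j = c' j) -> lincomb s c = lincomb s c'.
Proof. by move=> E; apply: eq_bigr => j _; rewrite E. Qed.

Lemma lincomb_rcons s x c :
  lincomb (rcons s x) c = lincomb s c + c (size s) *: x.
Proof.
rewrite /lincomb size_rcons big_ord_recr /= nth_rcons ltnn eqxx; congr (_ + _).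
by apply: eq_bigr => j _; rewrite nth_rcons ltn_ord.
Qed.

Lemma lincombD s c c' : lincomb s (fun j => c j + c' j) = lincomb s c + lincomb s c'.
Proof. by rewrite /lincomb -big_split; apply: eq_bigr => j _; rewrite scalerDl. Qed.

Lemma lincombZ s a c : lincomb s (fun j => a * c j) = a *: lincomb s c.
Proof. by rewrite /lincomb scaler_sumr; apply: eq_bigr => j _; rewrite scalerA. Qed.

Lemma lincombB s c c' : lincomb s (fun j => c j - c' j) = lincomb s c - lincomb s c'.
Proof.
rewrite /lincomb -sumrB; apply: eq_bigr => j _; by rewrite scalerBl.
Qed.

Lemma lincomb_delta s i : (i < size s)%N ->
  lincomb s (fun j => (j == i)%:R) = s`_i.
Proof.
move=> lt; rewrite /lincomb (bigD1 (Ordinal lt))//= eqxx scale1r big1 ?addr0// => j.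
by rewrite -val_eqE /= => /negbTE ->; rewrite scale0r.
Qed.

Lemma lin_indep_inj s c c' : lin_indep s -> lincomb s c = lincomb s c' ->
  forall j, (j < size s)%N -> c j = c' j.
Proof.
move=> si E j lt; apply/eqP; rewrite -subr_eq0; apply/eqP.
by apply: (si (fun j => c j - c' j)) => //; rewrite lincombB E subrr.
Qed.
End LinComb.

Section LinCombVect.
Variables (F : fieldType) (V : vectType F).
Implicit Types (s : seq V).

Lemma lincomb_span s c : lincomb s c \in <<s>>%VS.
Proof. by apply: memv_suml => j _; apply/memvZ/memv_span/mem_nth. Qed.

Lemma span_lincomb s x : x \in <<s>>%VS -> exists c, x = lincomb s c.
Proof.
move=> xs; pose c j := if insub j is Some j' then coord (in_tuple s) j' x else 0.
exists c; rewrite [LHS](coord_span (X := in_tuple s) xs).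
by apply: eq_bigr => j _; rewrite /c valK.
Qed.

Lemma free_lin_indep s : free s <-> lin_indep s.
Proof.
split=> [/(@freeP _ _ _ (in_tuple s)) fs c c0 j lt|si].
  exact: (fs (fun j => c j) c0 (Ordinal lt)).
apply/(@freeP _ _ _ (in_tuple s)) => c c0 j.
pose c' j := if insub j is Some j' then c j' else 0.
have <- : c' j = c j by rewrite /c' valK.
apply: si; last exact: ltn_ord.
by rewrite -[RHS]c0; apply: eq_bigr => k _; rewrite /c' valK.
Qed.
End LinCombVect.

(** * Ultrametric norms over a complete field *)

(** Both kinds of norms become ultrametric norms with the [max] convention:
    [rho_up] for the valuation [nu_up], and [- rho_down] for the valuation
    [- nu_down]. Nothing is required of [v] here. *)
Record ultranorm (R : realType) (F : fieldType) (v : F -> \bar R)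
    (V : vectType F) := Ultranorm {
  nrm :> V -> \bar R;
  nrm_fin : forall x, (nrm x != +oo)%E;
  nrm_eqNy : forall x, nrm x = -oo%E <-> x = 0;
  nrmZ : forall l x, nrm (l *: x) = (nrm x - v l)%E;
  nrmD : forall x y, (nrm (x + y) <= maxe (nrm x) (nrm y))%E }.

(** Sequences that are Cauchy at a linear rate converge, at the same rate; this
    instance of completeness suffices for the approximation argument below. *)
Definition complete_val (R : realType) (F : fieldType) (v : F -> \bar R) : Prop :=
  forall (a : nat -> F) (C : R),
    (forall n m, (n <= m)%N -> ((n%:R + C)%:E <= v (a m - a n)%R)%E) ->
    exists l, forall n, ((n%:R + C)%:E <= v (l - a n)%R)%E.

(** Distinct elements of [G] are at distance at least [eps]. *)
Definition separated_by (R : realType) (G : zmodClosed R) (eps : R) : Prop :=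
  forall g, g \in G -> `|g| < eps -> g = 0.

Section Separated.
Variables (R : realType) (G : zmodClosed R) (eps : R).
Hypotheses (eps0 : 0 < eps) (sepG : separated_by G eps).

(** A nonempty set that is bounded below and contained in finitely many cosets of
    [G] has a minimum: in one coset two elements at distance less than [eps] are
    equal, so an element within [eps] of the infimum is the minimum. *)
Lemma coset_min (t : seq R) (A : set R) : (A !=set0)%classic ->
  (forall x, A x -> exists2 u, u \in t & x - u \in G) ->
  (exists m, forall x, A x -> m <= x) ->
  exists2 x, A x & forall y, A y -> x <= y.
Proof.
move=> A0 At [m Am]; elim: t A A0 At Am => [|u t IH] A A0 At Am.
  by have [x Ax] := A0; have [u] := At x Ax.
pose B := (A `&` [set x | x - u \in G])%classic.
pose B' := (A `&` [set x | exists2 u', u' \in t & x - u' \in G])%classic.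
have cover x : A x -> B x \/ B' x.
  move=> Ax; have [u' + xu'] := At x Ax; rewrite inE => /orP[/eqP E|ut].
    by left; split=> //; rewrite -E.
  by right; split=> //; exists u'.
have minB : (B !=set0)%classic -> exists2 x, B x & forall y, B y -> x <= y.
  move=> B0.
  have hB : has_inf B by split=> //; exists m => x [/Am].
  have [x Bx lt] := inf_adherent eps0 hB.
  exists x => // y By; rewrite leNgt; apply/negP => yx.
  have ym : inf B <= y by apply: inf_lbound hB.2 _ By.
  have E : x - y = 0.
    apply: sepG.
      have -> : x - y = (x - u) - (y - u) by rewrite opprB subrKA.
      by apply: rpredB; [exact: Bx.2|exact: By.2].
    by rewrite gtr0_norm ?subr_gt0// ltrBlDr (lt_le_trans lt)// addrC lerD2l.
  by move: yx; rewrite -subr_gt0 E ltxx.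
have [B0|/set0P B0] := eqVneq B set0.
  have sub x : A x -> B' x by move=> /cover[|//]; rewrite B0.
  by apply: IH => // x /sub[].
have [b [Ab bu] bmin] := minB B0.
have [B0'|/set0P B0'] := eqVneq B' set0.
  by exists b => // y /cover[/bmin//|]; rewrite B0'.
have [c [Ac _] cmin] : exists2 x, B' x & forall y, B' y -> x <= y.
  by apply: IH => // x [] // /Am.
have [bc|/ltW cb] := leP b c.
  by exists b => // y /cover[/bmin//|/cmin]; apply: le_trans.
by exists c => // y /cover[/bmin|/cmin//]; apply: le_trans.
Qed.
End Separated.

Section Ultranorm.
Variables (R : realType) (F : fieldType) (v : F -> \bar R) (G : zmodClosed R).
Hypotheses (v0 : v 0 = +oo%E)
  (vG : forall l, l != 0 -> exists2 g, g \in G & v l = g%:E).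
Variables (V : vectType F) (r : ultranorm v V).
Implicit Types (x y : V) (l : F) (s : seq V).

Lemma nrm0 : r 0 = -oo%E. Proof. exact/nrm_eqNy. Qed.

Lemma nrm_real x : x != 0 -> exists a : R, r x = a%:E.
Proof.
move=> x0; case E : (r x) => [a| |]; first by exists a.
  by have := nrm_fin r x; rewrite E.
by move/nrm_eqNy: E x0 => ->; rewrite eqxx.
Qed.

Lemma nrm_lt_real (c : \bar R) x : (r x < c)%E -> exists2 a : R, (r x <= a%:E)%E & (a%:E < c)%E.
Proof.
case: c => [c| |] rc.
- have [->|x0] := eqVneq x 0.
    by exists (c - 1); rewrite ?nrm0 ?leNye// lte_fin ltrBlDr ltrDl.
  by have [a E] := nrm_real x0; exists a; rewrite ?E// -E.
- have [->|x0] := eqVneq x 0; first by exists 0; rewrite ?nrm0 ?leNye// ltry.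
  by have [a E] := nrm_real x0; exists a; rewrite ?E// -E.
- by rewrite ltNge leNye in rc.
Qed.

Lemma nrmN x : r (- x) = r x.
Proof.
have [->|x0] := eqVneq x 0; first by rewrite oppr0.
have [g _ vN1] : exists2 g, g \in G & v (-1) = g%:E.
  by apply: vG; rewrite oppr_eq0 oner_eq0.
have E y : r (- y) = (r y - g%:E)%E by rewrite -scaleN1r nrmZ vN1.
have [a ra] := nrm_real x0.
have : r (- - x) = r x by rewrite opprK.
rewrite [in LHS]E [in LHS]E ra -!EFinB => -[] /eqP.
rewrite -addrA -{2}[a]addr0 (inj_eq (addrI a)) -opprD oppr_eq0 -mulr2n.
by rewrite mulrn_eq0 /= => /eqP g0; rewrite E ra g0 -EFinB subr0.
Qed.

Lemma nrmB x y : (r (x - y)%R <= maxe (r x) (r y))%E.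
Proof. by rewrite -[r y]nrmN nrmD. Qed.

Lemma nrmD_le c x y : (r x <= c -> r y <= c -> r (x + y)%R <= c)%E.
Proof. by move=> xc yc; apply: le_trans (nrmD r x y) _; rewrite ge_max xc. Qed.

Lemma nrmB_le c x y : (r x <= c -> r y <= c -> r (x - y)%R <= c)%E.
Proof. by rewrite -[r y]nrmN; exact: nrmD_le. Qed.

Lemma nrm_sum_le (I : finType) (P : pred I) (f : I -> V) c :
  (forall i, P i -> r (f i) <= c)%E -> (r (\sum_(i | P i) f i)%R <= c)%E.
Proof.
move=> fc; elim/big_ind: _ => //; first by rewrite nrm0 leNye.
by move=> x y; exact: nrmD_le.
Qed.

Lemma nrm_sum_lt (I : finType) (P : pred I) (f : I -> V) c :
  (-oo < c)%E -> (forall i, P i -> r (f i) < c)%E ->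
  (r (\sum_(i | P i) f i)%R < c)%E.
Proof.
move=> c0 fc; elim/big_ind: _ => //; first by rewrite nrm0.
by move=> x y xc yc; apply: le_lt_trans (nrmD r x y) _; rewrite gt_max xc.
Qed.

Lemma nrmD_eq x y : (r y < r x)%E -> r (x + y) = r x.
Proof.
move=> lt; apply/le_anti/andP; split; first by apply: nrmD_le => //; exact: ltW.
rewrite leNgt; apply/negP => lt'; have : (r x < r x)%E; last by rewrite ltxx.
rewrite -[in X in (X < _)%E](addrK y x).
by apply: le_lt_trans (nrmB _ _) _; rewrite gt_max lt'.
Qed.

(** No cancellation occurs in combinations of [s]. *)
Definition orthogonal_seq s : Prop := forall (l : nat -> F) i, (i < size s)%N ->
  (r (l i *: s`_i)%R <= r (lincomb s l))%E.

Lemma orthogonal_indep s : 0 \notin s -> orthogonal_seq s -> lin_indep s.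
Proof.
move=> s0 os l l0 i lt; have := os l i lt.
rewrite l0 nrm0 leeNy_eq => /eqP/nrm_eqNy/eqP; rewrite scaler_eq0 => /orP[/eqP//|/eqP E].
by move: s0; rewrite -E mem_nth.
Qed.

Lemma orthogonal_nrm s (l : nat -> F) : (exists2 i, (i < size s)%N & l i *: s`_i != 0) ->
  orthogonal_seq s ->
  exists2 i, (i < size s)%N & l i *: s`_i != 0 /\ r (lincomb s l) = r (l i *: s`_i).
Proof.
move=> [i0 lt0 n0] os.
pose i1 := [arg max_(i > Ordinal lt0) r (l i *: s`_i)]%O.
have max1 (i : 'I_(size s)) : (r (l i *: s`_i)%R <= r (l i1 *: s`_i1))%E.
  by rewrite /i1; case: arg_maxP => // j _ /(_ i isT).
exists i1 => //; split.
  apply/negP => /eqP E; have := max1 (Ordinal lt0).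
  by rewrite E nrm0 leeNy_eq => /eqP/nrm_eqNy/eqP; rewrite (negbTE n0).
apply/le_anti/andP; split; last exact: os.
by apply: nrm_sum_le => i _; exact: max1.
Qed.

(** The norm of a combination is attained at one of its terms, hence it differs
    from the norm of a member of [s] by an element of [G]. *)
Lemma orthogonal_values s x : orthogonal_seq s -> x \in <<s>>%VS -> x != 0 ->
  exists2 u, u \in [seq fine (r y) | y <- s] & fine (r x) - u \in G.
Proof.
move=> os /span_lincomb[l ->] n0.
have [i lt [n0i E]] : exists2 i, (i < size s)%N &
    l i *: s`_i != 0 /\ r (lincomb s l) = r (l i *: s`_i).
  apply: orthogonal_nrm => //; apply: contra_notP (negP n0) => none.
  rewrite /lincomb big1// => i _; apply/eqP; apply: contra_notT none => h.
  by exists i.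
exists (fine (r s`_i)); first by apply: map_f; apply: mem_nth.
move: n0i; rewrite scaler_eq0 negb_or => /andP[li0 si0].
have [g Gg vl] := vG li0; have [a ra] := nrm_real si0.
by rewrite E nrmZ vl ra /= addrAC subrr add0r rpredN.
Qed.

Section Complete.
Variable eps : R.
Hypotheses (eps0 : 0 < eps) (sepG : separated_by G eps) (vc : complete_val v).

(** A vector outside the span of an orthogonal family has a best approximation in
    it. If the distance were not attained, every [r (x - w)] would be the norm of an
    element of the span, so these values would be unbounded below by [coset_min],
    and the corresponding approximations would converge to [x] in the span. *)
Lemma orthogonal_best_approx s x : 0 \notin s -> orthogonal_seq s -> x \notin <<s>>%VS ->
  exists2 w, w \in <<s>>%VS &
    forall w', w' \in <<s>>%VS -> (r (x - w)%R <= r (x - w')%R)%E.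
Proof.
move=> s0 os xs; apply: contrapT => none.
have better w : w \in <<s>>%VS ->
    exists2 w', w' \in <<s>>%VS & (r (x - w')%R < r (x - w)%R)%E.
  move=> ws; apply: contrapT => nw; apply: none; exists w => // w' ws'.
  by rewrite leNgt; apply/negP => lt; apply: nw; exists w'.
have ne w : w \in <<s>>%VS -> x - w != 0.
  by move=> ws; apply: contra xs; rewrite subr_eq0 => /eqP ->.
pose D := [set d | exists2 w, w \in <<s>>%VS & r (x - w) = d%:E]%classic.
have unbounded C : exists2 w, w \in <<s>>%VS & (r (x - w)%R <= C%:E)%E.
  apply: contrapT => nC.
  have [d [w ws E] dmin] : exists2 d, D d & forall d', D d' -> d <= d'.
    apply: (coset_min eps0 sepG (t := [seq fine (r y) | y <- s])).
    - have [d E] := nrm_real (ne 0 (mem0v _)).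
      by exists d, 0; rewrite ?mem0v.
    - move=> d [w ws E]; have [w' ws' lt] := better w ws.
      have dE : r (w' - w) = r (x - w).
        rewrite -(nrmD_eq (x := x - w) (y := - (x - w'))) ?nrmN//.
        by rewrite [in RHS]addrC opprB subrKA.
      have [||u us uG] := orthogonal_values (x := w' - w) os.
      + by rewrite memvB.
      + by apply/eqP => /(nrm_eqNy r); rewrite dE E.
      by exists u => //; move: uG; rewrite dE E.
    - exists C => d [w ws E]; rewrite leNgt; apply/negP => dC; apply: nC.
      by exists w => //; rewrite E lee_fin ltW.
  have [w' ws' lt] := better w ws; have [d' E'] := nrm_real (ne w' ws').
  by move: lt; rewrite E E' lte_fin ltNge dmin//; exists w'.
have [f fs] : {f : nat -> nat -> F & forall n, (r (x - lincomb s (f n))%R <= (- n%:R)%:E)%E}.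
  have ex n : {c : nat -> F | (r (x - lincomb s c)%R <= (- n%:R)%:E)%E}.
    apply: cid; have [w /span_lincomb[c ->] le] := unbounded (- n%:R).
    by exists c.
  by exists (fun n => sval (ex n)) => n; exact: (svalP (ex n)).
have lim i : exists l, (i < size s)%N -> forall n, (r ((l - f n i) *: s`_i)%R <= (- n%:R)%:E)%E.
  have [lt|] := boolP (i < size s)%N; last by exists 0.
  have si0 : s`_i != 0 by apply: contraNneq s0 => <-; exact: mem_nth.
  have [a ra] := nrm_real si0.
  have conv l n : (r (l *: s`_i)%R <= (- n%:R)%:E)%E = ((n%:R + a)%:E <= v l)%E.
    have [->|l0] := eqVneq l 0; first by rewrite scale0r nrm0 v0 leNye leey.
    have [g _ vl] := vG l0; rewrite nrmZ vl ra -EFinB !lee_fin.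
    by rewrite lerBlDr [- _ + _]addrC lerBrDr addrC.
  have [n m nm|l ln] := vc (a := fun n => f n i) (C := a).
    rewrite -conv; apply: le_trans (os (fun i => f m i - f n i) i lt) _.
    rewrite lincombB; have -> : lincomb s (f m) - lincomb s (f n) =
        (x - lincomb s (f n)) - (x - lincomb s (f m)).
      by rewrite opprB [in RHS]addrC subrKA.
    apply: nrmB_le; last first.
      by apply: le_trans (fs m) _; rewrite lee_fin lerN2 ler_nat.
    exact: fs.
  by exists l => _ n; rewrite conv.
have [l ll] : {l : nat -> F | forall i, (i < size s)%N ->
    forall n, (r ((l i - f n i) *: s`_i)%R <= (- n%:R)%:E)%E}.
  by exists (fun i => sval (cid (lim i))) => i; exact: (svalP (cid (lim i))).
have small n : (r (x - lincomb s l)%R <= (- n%:R)%:E)%E.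
  have -> : x - lincomb s l = (x - lincomb s (f n)) - (lincomb s l - lincomb s (f n)).
    by rewrite opprB subrKA.
  apply: nrmB_le; rewrite // -lincombB.
  by apply: nrm_sum_le => i _; apply: ll.
have [a ra] := nrm_real (ne _ (lincomb_span s l)).
have := small (Num.bound `|a|); rewrite ra lee_fin lerNr leNgt => /negP; apply.
by apply: le_lt_trans (ler_norm _) _; rewrite normrN archi_boundP.
Qed.

(** The difference [y] between [x] and its best approximation has minimal norm in
    its class modulo the span, which makes it orthogonal to the span. *)
Lemma orthogonal_extend s x : 0 \notin s -> orthogonal_seq s -> x \notin <<s>>%VS ->
  exists y, 0 \notin rcons s y /\ orthogonal_seq (rcons s y).
Proof.
move=> s0 os xs; have [w ws wmin] := orthogonal_best_approx s0 os xs.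
pose y := x - w; exists y.
have y0 : y != 0 by apply: contra xs; rewrite subr_eq0 => /eqP ->.
have ymin z : z \in <<s>>%VS -> (r y <= r (y + z)%R)%E.
  move=> zs; have -> : y + z = x - (w - z) by rewrite /y opprB addrA addrAC.
  by apply: wmin; rewrite memvB.
clearbody y; have maxy z : z \in <<s>>%VS -> (r y <= r (y + z)%R /\ r z <= r (y + z)%R)%E.
  move=> zs; split; first exact: ymin.
  have [le|lt] := leP (r z) (r y); first exact: le_trans le (ymin _ zs).
  by rewrite addrC nrmD_eq.
have maxl l z : z \in <<s>>%VS ->
    (r (l *: y)%R <= r (z + l *: y)%R /\ r z <= r (z + l *: y)%R)%E.
  move=> zs; have [->|l0] := eqVneq l 0; first by rewrite scale0r nrm0 leNye addr0.
  have [g _ vl] := vG l0.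
  have -> : z + l *: y = l *: (y + l^-1 *: z).
    by rewrite scalerDr scalerA mulfV// scale1r addrC.
  have zE : z = l *: (l^-1 *: z) by rewrite scalerA mulfV// scale1r.
  rewrite {2}zE.
  rewrite !(nrmZ r l) vl !leeD2rE//.
  by apply: maxy; rewrite memvZ.
split; first by rewrite mem_rcons inE negb_or eq_sym y0.
move=> l i; rewrite size_rcons lincomb_rcons nth_rcons ltnS leq_eqVlt.
have [h1 h2] := maxl (l (size s)) _ (lincomb_span s l).
case: eqVneq => [->|_] /=; first by rewrite ltnn.
move=> lt; rewrite lt; exact: le_trans (os l i lt) h2.
Qed.

Lemma orthogonal_basis_exists :
  exists2 s, 0 \notin s & orthogonal_seq s /\ <<s>>%VS = fullv.
Proof.
have [s [s0 os ss]] : exists s, [/\ 0 \notin s, orthogonal_seq s & size s = \dim {:V}].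
  have : (\dim {:V} <= \dim {:V})%N by [].
  elim: {1 3}(\dim {:V}) => [_|n IH lt]; first by exists [::].
  have [s [s0 os ss]] := IH (ltnW lt).
  have /subvPn[x _ xs] : ~~ ({:V} <= <<s>>)%VS.
    apply/negP => /dimvS; rewrite leqNgt.
    by rewrite (leq_ltn_trans (dim_span s))// ss.
  have [y [y0 oy]] := orthogonal_extend s0 os xs.
  by exists (rcons s y); rewrite size_rcons ss.
exists s => //; split=> //; apply/eqP; rewrite eqEdim subvf /=.
have /free_lin_indep := orthogonal_indep s0 os.
by rewrite /free ss => /eqP ->.
Qed.

(** Finite values of the norm lie in finitely many cosets of [G]. *)
Lemma nrm_values : exists t : seq R, forall x, x != 0 ->
  exists2 u, u \in t & fine (r x) - u \in G.
Proof.
have [s s0 [os ss]] := orthogonal_basis_exists.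
exists [seq fine (r y) | y <- s] => x; apply: orthogonal_values => //.
by rewrite ss memvf.
Qed.

Lemma linear_bounded (f : V -> V) : linear f ->
  exists C : R, forall x, (r (f x) <= r x + C%:E)%E.
Proof.
move=> f_lin; pose p : {linear V -> V} := HB.pack f (GRing.isLinear.Build _ _ _ _ f f_lin).
have [s s0 [os ss]] := orthogonal_basis_exists.
pose C := \big[Num.max/0]_(y <- s) (fine (r (p y)) - fine (r y)).
exists C => x; have /span_lincomb[l xE] : x \in <<s>>%VS by rewrite ss memvf.
rewrite -[f x]/(p x) {1}xE /lincomb linear_sum; apply: nrm_sum_le => i _; rewrite linearZ /=.
have si0 : s`_i != 0 by apply: contraNneq s0 => <-; exact: mem_nth.
have [->|l0] := eqVneq (l i) 0; first by rewrite scale0r nrm0 leNye.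
have [fs0|p0] := eqVneq (f s`_i) 0; first by rewrite fs0 scaler0 nrm0 leNye.
have [g _ vl] := vG l0; have [a ra] := nrm_real si0; have [b rb] := nrm_real p0.
have [le1 le2] : (r (l i *: s`_i)%R <= r x)%E /\ b - a <= C.
  split; first by rewrite xE; apply: os.
  by rewrite /C (big_nth 0) big_mkord (bigD1 i)//= rb ra le_max lexx.
apply: le_trans (leeD2r _ le1); rewrite !nrmZ vl ra rb -!EFinB -EFinD lee_fin.
by rewrite addrAC lerD2r -lerBlDl.
Qed.

(** The terms of a combination of independent vectors are bounded by the
    combination, up to a constant factor (additive on the scale of [r]). *)
Lemma free_bounded s : lin_indep s -> exists C : R, forall (c : nat -> F) i,
  (i < size s)%N -> (r (c i *: s`_i)%R <= r (lincomb s c) + C%:E)%E.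
Proof.
move=> /free_lin_indep fs.
have ex (i : 'I_(size s)) : exists C : R, forall c : nat -> F,
    (r (c i *: s`_i)%R <= r (lincomb s c) + C%:E)%E.
  have [|C CP] := @linear_bounded (fun x => coord (in_tuple s) i x *: s`_i).
    by move=> a x y /=; rewrite linearP scalerDl scalerA.
  exists C => c; have := CP (lincomb s c).
  by rewrite /lincomb (coord_sum_free (X := in_tuple s) (fun i => c i)).
pose C := \big[Num.max/0]_(i < size s) sval (cid (ex i)).
exists C => c i lt; apply: le_trans (svalP (cid (ex (Ordinal lt))) c) _.
apply: leeD2l; rewrite lee_fin /C (bigD1 (Ordinal lt))//= le_max lexx//.
Qed.
End Complete.
End Ultranorm.

(** * Extension of scalars to a field *)

Section MaximalFamilies.
Variables (A : idomainType) (H : lmodType A).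
Implicit Types (s b : seq H).

(** [a] is a denominator for the coordinates of [x] on [b]. *)
Definition cleared (a : A) b (x : H) : Prop := exists c, a *: x = lincomb b c.

Lemma cleared_lincomb a b s c :
  (forall j, (j < size s)%N -> cleared a b s`_j) -> cleared a b (lincomb s c).
Proof.
elim/last_ind: s => [|s x IH] h.
  exists (fun=> 0); rewrite /lincomb big_ord0 scaler0.
  by rewrite big1// => j _; rewrite scale0r.
have [|d dE] := IH.
  by move=> j lt; have := h j; rewrite size_rcons nth_rcons lt; apply; rewrite ltnW.
have [e eE] : cleared a b x.
  by have := h (size s); rewrite size_rcons nth_rcons ltnn eqxx; apply.
exists (fun j => d j + c (size s) * e j).
by rewrite lincomb_rcons lincombD lincombZ scalerDr dE -eE !scalerA mulrC.
Qed.

Lemma maximal_extension s (X : seq H) : lin_indep s ->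
  exists t a, [/\ lin_indep (s ++ t), a != 0 &
    forall x, x \in X -> cleared a (s ++ t) x].
Proof.
move=> si; elim: X => [|x X [t [a [ti a0 aX]]]].
  by exists [::], 1; rewrite cats0 oner_eq0.
have [xi|xd] := pselect (lin_indep (rcons (s ++ t) x)).
  exists (rcons t x), a; rewrite -rcons_cat; split=> // y; rewrite inE.
  case/orP=> [/eqP ->|/aX [c cE]].
    exists (fun j => if j == size (s ++ t) then a else 0).
    rewrite lincomb_rcons eqxx (eq_lincomb (c' := fun=> 0)) ?/lincomb ?big1 ?add0r//.
      by move=> j _; rewrite scale0r.
    by move=> j lt; rewrite ltn_eqF.
  exists (fun j => if j == size (s ++ t) then 0 else c j).
  rewrite lincomb_rcons eqxx scale0r addr0 cE.
  by apply: eq_lincomb => j lt; rewrite ltn_eqF.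
move/existsNP: xd => [c /not_implyP[c0 /existsNP[j /not_implyP[lt cj]]]].
have cx0 : c (size (s ++ t)) != 0.
  apply: contra_notN cj => /eqP cs; move: lt; rewrite size_rcons ltnS leq_eqVlt.
  case/orP=> [/eqP -> //|lt]; apply: (ti c) => //.
  by move: c0; rewrite lincomb_rcons cs scale0r addr0.
exists t, (a * c (size (s ++ t))); rewrite mulf_neq0//; split=> // y; rewrite inE.
case/orP=> [/eqP ->|/aX[d dE]].
  exists (fun j => (- a) * c j); rewrite lincombZ scaleNr -scalerA -scalerN; congr (_ *: _).
  by apply/eqP; rewrite -addr_eq0 addrC -lincomb_rcons c0.
by exists (fun j => c (size (s ++ t)) * d j); rewrite lincombZ -dE scalerA mulrC.
Qed.

(** Every independent family of a finitely generated module extends to one on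
    which all elements have coordinates with a common denominator. *)
Lemma maximal_family s : finitely_generated H -> lin_indep s ->
  exists t a, [/\ lin_indep (s ++ t), a != 0 & forall x, cleared a (s ++ t) x].
Proof.
move=> [n [X spX]] si; have [t [a [ti a0 aX]]] := maximal_extension X si.
exists t, a; split=> // x; have [c ->] := spX x.
have -> : \sum_(i < n) c i *: tnth X i =
    lincomb X (fun j => if insub j is Some j' then c j' else 0).
  rewrite /lincomb size_tuple; apply: eq_bigr => i _.
  by rewrite valK (tnth_nth 0).
by apply: cleared_lincomb => j lt; apply/aX/mem_nth.
Qed.
End MaximalFamilies.

Section Coordinates.
Variables (A : idomainType) (F : fieldType) (i : {rmorphism A -> F}) (H : lmodType A).
Variables (b : seq H) (a : A).
Hypotheses (bi : lin_indep b) (ba : forall x, cleared a b x).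

(** Numerators of the coordinates of [x] on [b], for the denominator [a]. *)
Definition numer (x : H) : nat -> A := projT1 (cid (ba x)).

Lemma numerE x : a *: x = lincomb b (numer x).
Proof. exact: projT2 (cid (ba x)). Qed.

Lemma numer_linear k c x y : (k < size b)%N ->
  numer (c *: x + y) k = c * numer x k + numer y k.
Proof.
move=> lt; apply: (lin_indep_inj bi _ lt (c' := fun k => c * numer x k + numer y k)).
rewrite lincombD lincombZ -!numerE scalerDr !scalerA; congr (_ + _).
by rewrite mulrC.
Qed.

(** The [k]-th coordinate on the maximal family [b], as an element of [F]. *)
Definition coordinate (k : 'I_(size b)) (x : H) : F^o := i (numer x k) / i a.

Fact coordinate_linear k : linear_for (i \; *:%R) (coordinate k).
Proof.
move=> c x y; rewrite /coordinate numer_linear// rmorphD rmorphM mulrDl /=.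
by rewrite -mulrA.
Qed.
Definition coordinate_lin k : {linear H -> F^o | i \; *:%R} :=
  HB.pack (coordinate k) (GRing.isLinear.Build A H F^o (i \; *:%R)
    (coordinate k) (coordinate_linear k)).
End Coordinates.

Section BaseChange.
Variables (A : idomainType) (F : fieldType) (i : {rmorphism A -> F}).
Hypothesis i_inj : injective i.
Variables (H : lmodType A) (V : vectType F) (phi : {linear H -> V | i \; *:%R}).

Lemma rmorph_neq0 a : a != 0 -> i a != 0.
Proof. by apply: contra => /eqP; rewrite -(rmorph0 i) => /i_inj ->. Qed.

Lemma phi_lincomb s c : phi (lincomb s c) = lincomb (map phi s) (i \o c).
Proof.
rewrite /lincomb linear_sum size_map; apply: eq_bigr => j _.
by rewrite linearZ /= (nth_map 0).
Qed.

Lemma indep_of_phi s : lin_indep (map phi s) -> lin_indep s.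
Proof.
move=> si c c0 j lt; apply: i_inj; rewrite rmorph0; apply: (si (i \o c)).
  by rewrite -phi_lincomb c0 linear0.
by rewrite size_map.
Qed.

Lemma torsion_phi x : x \in @torsion A H -> phi x = 0.
Proof.
move=> /torsionP[a a0 ax]; have : phi (a *: x) = 0 by rewrite ax linear0.
by rewrite linearZ /= => /eqP; rewrite scaler_eq0 (negbTE (rmorph_neq0 a0)) => /eqP.
Qed.

Hypotheses (fgH : finitely_generated H) (phi_bij : bijective (tensor_lift phi)).

(** A relation between the images lifts to a relation in the tensor product, where
    the coordinates on a maximal family extending [s] detect its coefficients. *)
Lemma indep_phi s : lin_indep s -> lin_indep (map phi s).
Proof.
move=> si c c0 j; rewrite size_map => lt.
have [t [a [bi a0 ba]]] := maximal_family fgH si.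
have ltb : (j < size (s ++ t))%N by rewrite size_cat ltn_addr.
pose tau : tensor i H := \pi_(tensor i H)%qT (mkseq (fun k => (c k, s`_k)) (size s)).
have sumE (W : lmodType F) (psi : {linear H -> W | i \; *:%R}) :
    tensor_lift psi tau = \sum_(k < size s) c k *: psi s`_k.
  by rewrite tensor_lift_cls /sum_seq big_map -{1}(subn0 (size s)) big_mkord.
have tau0 : tau = 0.
  apply: (bij_inj phi_bij); rewrite linear0 sumE -[RHS]c0 /lincomb size_map.
  by apply: eq_bigr => k _; rewrite (nth_map 0).
have := sumE _ (coordinate_lin i bi ba (Ordinal ltb)).
have numer_s k : (k < size s)%N -> numer ba s`_k j = a * (j == k)%:R.
  move=> ltk; apply: (lin_indep_inj bi (c' := fun j => a * (j == k)%:R)) ltb.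
  have ltk' : (k < size (s ++ t))%N by rewrite size_cat ltn_addr.
  by rewrite -numerE lincombZ lincomb_delta// nth_cat ltk.
rewrite tau0 linear0 (bigD1 (Ordinal lt))//= big1 => [|k kj].
  rewrite /= /coordinate /= numer_s// eqxx mulr1 divff ?rmorph_neq0// addr0.
  by rewrite /GRing.scale /= mulr1.
rewrite /= /coordinate /= numer_s// [j == k]eq_sym.
by move: kj; rewrite -val_eqE /= => /negbTE ->; rewrite mulr0 rmorph0 mul0r scaler0.
Qed.

Lemma phi_eq0 x : phi x = 0 <-> x \in @torsion A H.
Proof.
split; last exact: torsion_phi.
move=> x0; apply: contrapT => xt.
have : lin_indep [:: x].
  move=> c; rewrite /lincomb big_ord1 /= => cx [|//] _.
  apply/eqP; apply: contra_notT xt => c0; apply/torsionP; by exists (c 0).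
move=> /indep_phi/(_ (fun=> 1)); rewrite /lincomb big_ord1 /= x0 scaler0.
by move=> /(_ erefl 0 isT)/eqP; rewrite oner_eq0.
Qed.

Lemma span_phi (U : {vspace V}) : (forall x, phi x \in U) -> U = fullv.
Proof.
move=> hU; apply/eqP; rewrite eqEsubv subvf; apply/subvP => y _.
have [g _ gK] := phi_bij; rewrite -(gK y).
elim/tensor_ind: (g y) => s; rewrite tensor_lift_cls /sum_seq.
by apply: memv_suml => p _; rewrite memvZ.
Qed.
End BaseChange.

(** * Families of successive minima *)

Section SuccessiveMinima.
Variables (R : realType) (A : idomainType) (H : lmodType A).
Variables (F1 F2 : fieldType) (v1 : F1 -> \bar R) (v2 : F2 -> \bar R).
Variables (i1 : {rmorphism A -> F1}) (i2 : {rmorphism A -> F2}).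
Variables (V1 : vectType F1) (V2 : vectType F2).
Variables (r1 : ultranorm v1 V1) (r2 : ultranorm v2 V2).
Variables (phi1 : {linear H -> V1 | i1 \; *:%R}) (phi2 : {linear H -> V2 | i2 \; *:%R}).

(** The values [r1 + r2] at the members of [e] do not decrease, and the one at
    [e`_j] is least among the elements [y] with a nonzero multiple of the form
    [b 0 *: e`_0 + ... + b j *: e`_j] where [b j != 0]. The condition is symmetric
    in the two norms. *)
Definition successive_minima (e : seq H) (lam : nat -> R) : Prop :=
  [/\ forall j k, (j <= k < size e)%N -> lam j <= lam k,
      forall j, (j < size e)%N -> exists p q : R,
        [/\ r1 (phi1 e`_j) = p%:E, r2 (phi2 e`_j) = q%:E & lam j = p + q]
    & forall j y a b, (j < size e)%N -> a != 0 -> a *: y = lincomb e b ->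
        b j != 0 -> (forall k, (j < k < size e)%N -> b k = 0) ->
        forall p q : R, (r1 (phi1 y) <= p%:E)%E -> (r2 (phi2 y) <= q%:E)%E ->
        lam j <= p + q].

(** Every nonzero element of [F1] has the same leading term as some [a] in [A]
    whose two valuations are opposite, as for a monomial. *)
Definition leading_terms : Prop := forall l, l != 0 -> exists a (g : R),
  [/\ v1 l = g%:E, v1 (i1 a) = g%:E, v2 (i2 a) = (- g)%:E & (g%:E < v1 (l - i1 a)%R)%E].

(** If a combination has a norm smaller than its largest term, replacing the
    coefficients of the largest terms by their leading terms, and the others by 0,
    yields an element [y] contradicting the minimality at the last of these
    terms. *)
Lemma minima_orthogonal (G : zmodClosed R) e lam :
  v1 0 = +oo%E -> (forall l, l != 0 -> exists2 g, g \in G & v1 l = g%:E) ->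
  leading_terms -> successive_minima e lam -> orthogonal_seq r1 (map phi1 e).
Proof.
move=> v0 vG lead [mono vals min] l i; rewrite size_map => lti.
rewrite leNgt; apply/negP => lt.
pose f := map phi1 e; pose term k := r1 (l k *: f`_k).
(* [m] is the index of a largest term, which is nonzero since its norm exceeds
   that of the combination *)
pose i1x := [arg max_(k > Ordinal lti) term k]%O.
have max1 k : (k < size e)%N -> (term k <= term i1x)%E.
  move=> ltk; rewrite /i1x; case: arg_maxP => // j _ /(_ (Ordinal ltk)); exact.
have lti1 := ltn_ord i1x; set m := nat_of_ord i1x in max1 lti1.
have ltm : (r1 (lincomb f l) < term m)%E by apply: lt_le_trans lt (max1 _ lti).
have fE k : (k < size e)%N -> f`_k = phi1 e`_k by move=> ltk; rewrite (nth_map 0).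
have nz k : (term k == term m)%E -> l k != 0.
  move=> /eqP E; apply: contraTneq ltm => l0.
  by rewrite -E /term l0 scale0r nrm0 ltNge leNye.
have [M ME] : exists M : R, term m = M%:E.
  apply: nrm_real; apply: contraTneq ltm => E.
  by rewrite /term E nrm0 ltNge leNye.
have ex k : exists a : A, if term k == term m then exists g : R,
    [/\ v1 (l k) = g%:E, v1 (i1 a) = g%:E, v2 (i2 a) = (- g)%:E
      & (g%:E < v1 (l k - i1 a)%R)%E] else a = 0.
  case: (boolP (term k == term m)) => [/nz/lead[a [g h]]|_]; last by exists 0.
  by exists a, g.
have [a aP] : {a : nat -> A & forall k, if term k == term m then exists g : R,
    [/\ v1 (l k) = g%:E, v1 (i1 (a k)) = g%:E, v2 (i2 (a k)) = (- g)%:E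
      & (g%:E < v1 (l k - i1 (a k))%R)%E] else a k = 0}.
  by exists (fun k => sval (cid (ex k))) => k; exact: (svalP (cid (ex k))).
(* [jx] is the last index of a term of maximal norm [M] *)
pose S (k : 'I_(size e)) := term k == term m.
pose jx := [arg max_(k > i1x | S k) (k : nat)].
have [Sj maxj] : S jx /\ forall k : 'I_(size e), S k -> (k <= jx)%N.
  by rewrite /jx; case: arg_maxnP => //; rewrite /S eqxx.
have ltj := ltn_ord jx.
pose y := lincomb e a.
(* [phi1 y] differs from the given combination by terms of norm less than [M] *)
have y1 : (r1 (phi1 y) < M%:E)%E.
  have -> : phi1 y = lincomb f l + lincomb f (fun k => i1 (a k) - l k).
    by rewrite lincombB addrC subrK phi_lincomb.
  apply: le_lt_trans (nrmD r1 _ _) _; rewrite gt_max -ME ltm /= ME.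
  apply: (nrm_sum_lt (ltNyr _)) => -[k /= ltk _]; rewrite size_map in ltk.
  have := aP k; case: ifPn => [/eqP E [g [vl va _ lt']]|NE ->].
    rewrite -(nrmN vG) -scaleNr opprB nrmZ.
    have := E; rewrite ME /term nrmZ vl.
    have [->|f0] := eqVneq f`_k 0; first by rewrite nrm0.
    have [p ->] := nrm_real r1 f0; rewrite -EFinB => -[<-].
    by case: (v1 _) lt' => [h| |]//=; rewrite -?EFinB ?lte_fin ?ltrD2l ?ltrN2// ltNyr.
  rewrite rmorph0 sub0r scaleNr (nrmN vG) -ME lt_neqAle NE.
  exact: max1.
(* since the leading coefficient [a k] has opposite valuations, the [k]-th term
   has [r2] equal to [lam k - M] *)
have y2 : (r2 (phi2 y) <= (lam jx - M)%:E)%E.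
  rewrite phi_lincomb; apply: nrm_sum_le => -[k /= ltk _]; rewrite size_map in ltk.
  rewrite (nth_map 0)//; have := aP k; case: ifPn => [SE [g [vl _ va _]]|_ ->]; last first.
    by rewrite rmorph0 scale0r nrm0 leNye.
  have [p [q [pE qE lamE]]] := vals k ltk.
  have : term k = M%:E by rewrite (eqP SE).
  rewrite /term fE// nrmZ pE vl -EFinB => -[<-].
  rewrite nrmZ va qE -EFinB lee_fin opprK.
  have -> : q + g = lam k - (p - g) by rewrite lamE opprB [p + q]addrC -addrA [g - p]addrC addNKr.
  by rewrite lerD2r; apply: mono; rewrite ltj andbT; apply: (maxj (Ordinal ltk)).
have [p y1p] := nrm_lt_real y1; rewrite lte_fin => pM.
have aj0 : a jx != 0.
  have := aP jx; rewrite -/(S jx) Sj => -[g [_ va _ _]].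
  by apply: contra_eq_neq va => ->; rewrite rmorph0 v0.
have above k : (jx < k < size e)%N -> a k = 0.
  move=> /andP[jk ltk]; have := aP k; case: ifPn => // Sk _.
  by have := maxj (Ordinal ltk) Sk; rewrite /= leqNgt jk.
have := min jx y 1 a ltj (oner_neq0 _) (scale1r _) aj0 above p (lam jx - M) y1p y2.
by rewrite addrCA -lerBlDl subrr subr_ge0 leNgt pM.
Qed.

(** Division with remainder, for [v1] and [v2] the least exponent and the opposite
    of the greatest one: modulo [a], every [b] has a representative whose exponents
    lie in the half-open window obtained by translating by [s] the interval from the
    least to the greatest exponent of [a]. *)
Definition window_division : Prop := forall a b (s : R), a != 0 ->
  exists c, (s%:E + v1 (i1 a) <= v1 (i1 (b - c * a)%R))%E /\
            ((- s)%:E + v2 (i2 a) < v2 (i2 (b - c * a)%R))%E.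

(** Let [a *: y = b 0 *: e`_0 + ... + b n *: e`_n]. Subtracting a combination of
    [e] from [y] reduces the coefficients [b k] modulo [a]. With the windows placed
    at the values of [r1] on [e], the result [z] has [r1 + r2] less than [lam n];
    by minimality its coefficient at [n] vanishes, and induction applies. *)
Lemma minima_generate e lam a :
  (forall c, c != 0 -> exists g, v1 (i1 c) = g%:E) ->
  (forall c, c != 0 -> exists g, v2 (i2 c) = g%:E) ->
  window_division -> successive_minima e lam -> a != 0 -> (forall x, cleared a e x) ->
  forall x, exists c, x - lincomb e c \in @torsion A H.
Proof.
move=> v1G v2G divw [mono vals min] a0 ae x.
have [al alE] := v1G a a0; have [be beE] := v2G a a0.
suff red n b y : (n <= size e)%N -> a *: y = lincomb e b ->
    (forall k, (n <= k < size e)%N -> b k = 0) ->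
    exists c, y - lincomb e c \in @torsion A H.
  have [b bE] := ae x; apply: (red (size e) b) => // k /andP[le lt].
  by move: lt; rewrite ltnNge le.
elim: n b y => [|n IH] b y le yE b0.
  exists (fun=> 0); rewrite /lincomb big1 ?subr0; last by move=> k _; rewrite scale0r.
  apply/torsionP; exists a => //; rewrite yE /lincomb big1// => k _.
  by rewrite b0 ?scale0r//=.
have ex k : exists c, (n < k)%N /\ c = 0 \/ (k <= n)%N /\ forall p, r1 (phi1 e`_k) = p%:E ->
    ((p + al)%:E <= v1 (i1 (b k - c * a)%R))%E /\
    ((- p + be)%:E < v2 (i2 (b k - c * a)%R))%E.
  have [kn|nk] := leqP k n; last by exists 0; left.
  have [p [q [pE qE lE]]] := vals k (leq_ltn_trans kn le).
  have [c [c1 c2]] := divw a (b k) p a0; exists c; right; split=> // p'.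
  by rewrite pE => -[<-]; rewrite !EFinD -alE -beE.
have [c cP] : {c : nat -> A & forall k, (n < k)%N /\ c k = 0 \/ (k <= n)%N /\
    forall p, r1 (phi1 e`_k) = p%:E ->
    ((p + al)%:E <= v1 (i1 (b k - c k * a)%R))%E /\
    ((- p + be)%:E < v2 (i2 (b k - c k * a)%R))%E}.
  by exists (fun k => sval (cid (ex k))) => k; exact: (svalP (cid (ex k))).
pose z := y - lincomb e c; pose d k := b k - c k * a.
have zE : a *: z = lincomb e d.
  rewrite /z scalerBr yE -lincombZ -lincombB.
  by apply: eq_lincomb => k _; rewrite /d mulrC.
have d0 k : (n < k < size e)%N -> d k = 0.
  move=> /andP[nk ke]; have [[_ ck]|[]] := cP k; last by rewrite leqNgt nk.
  by rewrite /d ck mul0r subr0 b0// nk.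
(* the reduced coefficient at [n] vanishes, or else [z] contradicts minimality *)
have [dn0|dn] := eqVneq (d n) 0.
  have [|||c' c'P] := IH d z; [exact: ltnW|exact: zE| |].
    move=> k /andP[]; rewrite leq_eqVlt => /orP[/eqP <- //|nk ke].
    by rewrite d0// nk.
  by exists (fun k => c k + c' k); rewrite lincombD opprD addrA.
have z1 : (r1 (phi1 z) <= 0%:E)%E.
  have : (r1 (phi1 (a *: z)%R) <= (- al)%:E)%E.
    rewrite zE phi_lincomb; apply: nrm_sum_le => -[k /= ltk _]; rewrite size_map in ltk.
    rewrite (nth_map 0)//; have [kn|nk] := leqP k n; last first.
      by rewrite d0 ?nk// rmorph0 scale0r nrm0 leNye.
    have [[]|[_ h]] := cP k; first by rewrite ltnNge kn.
    have [p [q [pE qE lE]]] := vals k ltk; have [h1 _] := h p pE.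
    rewrite nrmZ pE; case: (v1 _) h1 => [g| |]//; last by rewrite /= leNye.
    by rewrite !lee_fin => h1; rewrite lerBlDr addrC lerBrDr.
  by rewrite linearZ /= nrmZ alE leeBlDr// -EFinD addNr.
have z2 : (r2 (phi2 z) < (lam n)%:E)%E.
  have : (r2 (phi2 (a *: z)%R) < (lam n - be)%:E)%E.
    rewrite zE phi_lincomb; apply: (nrm_sum_lt (ltNyr _)) => -[k /= ltk _].
    rewrite size_map in ltk.
    rewrite (nth_map 0)//; have [kn|nk] := leqP k n; last first.
      by rewrite d0 ?nk// rmorph0 scale0r nrm0 ltNyr.
    have [[]|[_ h]] := cP k; first by rewrite ltnNge kn.
    have [p [q [pE qE lE]]] := vals k ltk; have [_ h2] := h p pE.
    have lk : lam k <= lam n by apply: mono; rewrite kn.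
    rewrite nrmZ qE; case: (v2 _) h2 => [g| |]//; last by rewrite ltNyr.
    rewrite !lte_fin => h2; apply: lt_le_trans (_ : lam k - be <= _); last by rewrite lerD2r.
    by rewrite lE [p + q]addrC -addrA ltrD2l ltrNl opprB addrC.
  by rewrite linearZ /= nrmZ beE lteBlDr// -EFinD subrK.
have [q z2q] := nrm_lt_real z2; rewrite lte_fin ltNge => /negP; case.
by rewrite -[q]add0r; apply: (min n z a d).
Qed.
End SuccessiveMinima.

(** * Existence of successive minima *)

Section LinCombTake.
Variables (F : fieldType) (V : vectType F).
Implicit Types (s : seq V).

Lemma lin_indep_rcons s x : lin_indep s -> x \notin <<s>>%VS -> lin_indep (rcons s x).
Proof.
move=> /free_lin_indep fs xs; apply/free_lin_indep.
by rewrite (perm_free (Y := x :: s)) ?free_cons ?xs// perm_rcons.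
Qed.

(** A combination lying in the span of the first [j] members of an independent
    family has no coefficient from index [j] on. *)
Lemma lin_indep_take s j b k : lin_indep s -> lincomb s b \in <<take j s>>%VS ->
  (j <= k < size s)%N -> b k = 0.
Proof.
move=> si /span_lincomb[c cE] /andP[jk ks].
have js : (j <= size s)%N by apply: leq_trans jk (ltnW ks).
pose c' i := if (i < j)%N then c i else 0.
have E : lincomb s b = lincomb s c'.
  rewrite cE /lincomb size_takel// (big_ord_widen _ (fun i => c i *: (take j s)`_i) js).
  rewrite big_mkcond; apply: eq_bigr => i _; rewrite /c'.
  by case: ifP => ij; rewrite ?nth_take// scale0r.
by rewrite (lin_indep_inj si E ks) /c' ltnNge jk.
Qed.
End LinCombTake.

Section Existence.
Variables (R : realType) (G : zmodClosed R) (eps : R).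
Hypotheses (eps0 : 0 < eps) (sepG : separated_by G eps).
Variables (A : idomainType) (H : lmodType A).
Variables (F1 F2 : fieldType) (v1 : F1 -> \bar R) (v2 : F2 -> \bar R).
Hypotheses (v10 : v1 0 = +oo%E) (v20 : v2 0 = +oo%E).
Hypotheses (v1G : forall l, l != 0 -> exists2 g, g \in G & v1 l = g%:E)
  (v2G : forall l, l != 0 -> exists2 g, g \in G & v2 l = g%:E).
Hypotheses (v1c : complete_val v1) (v2c : complete_val v2).
Variables (i1 : {rmorphism A -> F1}) (i2 : {rmorphism A -> F2}).
Hypotheses (i1_inj : injective i1) (i2_inj : injective i2).
Hypothesis width_ge0 : forall a, a != 0 -> (v1 (i1 a) + v2 (i2 a) <= 0)%E.
Variables (V1 : vectType F1) (V2 : vectType F2).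
Variables (r1 : ultranorm v1 V1) (r2 : ultranorm v2 V2).
Variables (phi1 : {linear H -> V1 | i1 \; *:%R}) (phi2 : {linear H -> V2 | i2 \; *:%R}).
Hypotheses (fgH : finitely_generated H).
Hypotheses (phi1_bij : bijective (tensor_lift phi1)) (phi2_bij : bijective (tensor_lift phi2)).

(** The quantity to be minimized; it is [rho_up - rho_down] for the norms of a
    filtered matched pair. It is invariant under multiplication by monomials. *)
Definition height (x : H) : R := fine (r1 (phi1 x)) + fine (r2 (phi2 x)).

Lemma nrm_phi x : x \notin @torsion A H -> exists p q : R,
  [/\ r1 (phi1 x) = p%:E, r2 (phi2 x) = q%:E & height x = p + q].
Proof.
move=> xt.
have [p pE] : exists p : R, r1 (phi1 x) = p%:E.
  by apply: nrm_real; apply: contra xt => /eqP/(phi_eq0 i1_inj fgH phi1_bij).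
have [q qE] : exists q : R, r2 (phi2 x) = q%:E.
  by apply: nrm_real; apply: contra xt => /eqP/(phi_eq0 i2_inj fgH phi2_bij).
by exists p, q; rewrite /height pE qE.
Qed.

(** Each norm of [x] dominates, up to a constant, the norm of every term of
    [a *: x] on a maximal independent family [b]. At a nonzero term the two lower
    bounds add up to a constant, since [v1 + v2 <= 0] at its coefficient, an
    element of [A]. *)
Lemma height_bounded : exists m, forall x, x \notin @torsion A H -> m <= height x.
Proof.
have nil_indep : lin_indep ([::] : seq H) by [].
have [b [a [/= bi a0 ba]]] := maximal_family fgH nil_indep.
have [C1 C1P] := free_bounded v10 v1G r1 eps0 sepG v1c (indep_phi i1_inj fgH phi1_bij bi).
have [C2 C2P] := free_bounded v20 v2G r2 eps0 sepG v2c (indep_phi i2_inj fgH phi2_bij bi).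
have [al _ alE] := v1G (rmorph_neq0 i1_inj a0).
have [be _ beE] := v2G (rmorph_neq0 i2_inj a0).
pose m := \big[Num.min/0]_(k < size b) height b`_k.
exists (m + al + be - C1 - C2) => x xt.
have [c cE] := ba x.
have [j lt cj] : exists2 j, (j < size b)%N & c j != 0.
  apply: contra_notP (negP xt) => none; apply/torsionP; exists a => //.
  rewrite cE /lincomb big1// => j _; have -> : c j = 0; last by rewrite scale0r.
  by apply/eqP; apply: contra_notT none => cj; exists j.
have bj : b`_j \notin @torsion A H.
  apply/negP => /torsionP[a' a'0 bj0].
  have := bi (fun k => a' * (k == j)%:R); rewrite lincombZ lincomb_delta// bj0.
  by move=> /(_ erefl j lt); rewrite eqxx mulr1 => /eqP; rewrite (negbTE a'0).
have [p [q [pE qE hx]]] := nrm_phi xt; have [P [Q [PE QE hb]]] := nrm_phi bj.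
have [g _ gE] := v1G (rmorph_neq0 i1_inj cj); have [h _ hE] := v2G (rmorph_neq0 i2_inj cj).
have /= := C1P (i1 \o c) j; rewrite size_map => /(_ lt).
rewrite -phi_lincomb (nth_map 0)// -cE linearZ !nrmZ /= pE PE gE alE -!EFinB -EFinD lee_fin => le1.
have /= := C2P (i2 \o c) j; rewrite size_map => /(_ lt).
rewrite -phi_lincomb (nth_map 0)// -cE linearZ !nrmZ /= qE QE hE beE -!EFinB -EFinD lee_fin => le2.
have := width_ge0 cj; rewrite gE hE -EFinD lee_fin => gh.
have mle : m <= P + Q by rewrite -hb /m (bigD1 (Ordinal lt))//= ge_min lexx.
by rewrite hx; lra.
Qed.

(** The heights of these elements are bounded below and lie in finitely many
    cosets of [G], so the least one exists. *)
Lemma minima_step (U : {vspace V1}) : U != fullv ->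
  exists2 x, phi1 x \notin U & forall y, phi1 y \notin U -> height x <= height y.
Proof.
move=> Uf.
have ntor x : phi1 x \notin U -> x \notin @torsion A H.
  by apply: contra => /(torsion_phi i1_inj phi1) ->; rewrite mem0v.
have [t1 t1P] := nrm_values v10 v1G r1 eps0 sepG v1c.
have [t2 t2P] := nrm_values v20 v2G r2 eps0 sepG v2c.
pose D := [set d | exists2 x, phi1 x \notin U & height x = d]%classic.
have [d [x xU <-] dmin] : exists2 d, D d & forall d', D d' -> d <= d'.
  apply: (coset_min eps0 sepG (t := [seq u1 + u2 | u1 <- t1, u2 <- t2])).
  - apply: contrapT => none; move/eqP: Uf; apply.
    apply: (span_phi phi1_bij) => x; apply: contra_notT none => xU.
    by exists (height x), x.
  - move=> _ [x /ntor xt <-].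
    have [p [q [pE qE hx]]] := nrm_phi xt.
    have [|u1 u1t u1G] := t1P (phi1 x).
      by apply/eqP => /(nrm_eqNy r1); rewrite pE.
    have [|u2 u2t u2G] := t2P (phi2 x).
      by apply/eqP => /(nrm_eqNy r2); rewrite qE.
    exists (u1 + u2); first exact: allpairs_f.
    by rewrite /height opprD addrACA rpredD.
  - have [m mP] := height_bounded; exists m => _ [x /ntor xt <-].
    exact: mP.
by exists x => // y yU; apply: dmin; exists y.
Qed.

(** The next member of the family is an element of least height among those that
    are independent from the previous ones. *)
Lemma minima_exist : exists e lam,
  [/\ lin_indep (map phi1 e), <<map phi1 e>>%VS = fullv &
      successive_minima r1 r2 phi1 phi2 e lam].
Proof.
have [e [ei se emin]] : exists e, [/\ lin_indep (map phi1 e), size e = \dim {:V1} &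
    forall j y, (j < size e)%N -> phi1 y \notin <<take j (map phi1 e)>>%VS ->
      height e`_j <= height y].
  have : (\dim {:V1} <= \dim {:V1})%N by [].
  elim: {1 3}(\dim {:V1}) => [_|n IH lt]; first by exists [::]; split.
  have [e [ei se emin]] := IH (ltnW lt).
  have [|x xU xmin] := @minima_step <<map phi1 e>>%VS.
    apply: contraTneq lt => E; rewrite -leqNgt -E.
    by rewrite (leq_trans (dim_span _))// size_map se.
  exists (rcons e x); rewrite map_rcons size_rcons se; split=> //.
    exact: lin_indep_rcons.
  move=> j y; rewrite ltnS nth_rcons se leq_eqVlt -cats1 take_cat size_map se.
  case: eqVneq => [-> _|_ /= lt']; first by rewrite ltnn subnn take0 cats0; exact: xmin.
  by rewrite lt'; apply: emin; rewrite se.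
have outside j k y b : (j <= k < size e)%N -> b k != 0 ->
    phi1 y = lincomb (map phi1 e) b -> phi1 y \notin <<take j (map phi1 e)>>%VS.
  move=> jk bk yE; apply: contra bk; rewrite yE => h; apply/eqP.
  by apply: (lin_indep_take ei h); rewrite size_map.
have ntor j y : phi1 y \notin <<take j (map phi1 e)>>%VS -> y \notin @torsion A H.
  by apply: contra => /(torsion_phi i1_inj phi1) ->; rewrite mem0v.
have mem_out j k : (j <= k < size e)%N -> phi1 e`_k \notin <<take j (map phi1 e)>>%VS.
  move=> /andP[jk ke]; apply: (outside j k _ (fun i => (i == k)%:R)).
  - by rewrite jk.
  - by rewrite eqxx oner_neq0.
  - by rewrite lincomb_delta ?size_map// (nth_map 0).
exists e, (fun j => height e`_j); split=> //.
  apply/eqP; rewrite eqEdim subvf /= -se -(size_map phi1).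
  by move/free_lin_indep: ei; rewrite /free => /eqP ->.
split.
- move=> j k jk; apply: emin; last exact: mem_out.
  by case/andP: jk => jk; apply: leq_ltn_trans.
- by move=> j lt; apply: nrm_phi; apply: (ntor j); apply: mem_out; rewrite leqnn.
- move=> j y a b lt a0 ayE bj _ p q yp yq.
  have out : phi1 y \notin <<take j (map phi1 e)>>%VS.
    suff : phi1 (a *: y) \notin <<take j (map phi1 e)>>%VS.
      by apply: contra => h; rewrite linearZ /= memvZ.
    apply: (outside j j _ (i1 \o b)); rewrite ?leqnn//=.
      exact: rmorph_neq0.
    by rewrite ayE phi_lincomb.
  apply: le_trans (emin j y lt out) _.
  have [p' [q' [pE qE ->]]] := nrm_phi (ntor _ _ out).
  by apply: lerD; [rewrite -lee_fin -pE|rewrite -lee_fin -qE].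
Qed.
End Existence.

(** * Novikov fields over a discrete group *)

Lemma discrete_separated (R : realType) (G : zmodClosed R) : discrete_subgroup G ->
  exists2 eps, 0 < eps & separated_by G eps.
Proof.
move=> dG; have [_ [B]] := dG 0 (rpred0 G).
move=> B0 BG; have [eps /= eps0 epsB] := (nbhs_ballP _ _).1 B0; exists eps => // g Gg lt.
suff : (B `&` [set` G])%classic g by rewrite BG.
by split=> //; apply: epsB; rewrite -ball_normE /= sub0r normrN.
Qed.

Section Completeness.
Variables (R : realType) (K : fieldType) (G : zmodClosed R) (S : supports R).
Variable u : {additive R -> R}.
Hypothesis SE : forall A, S A <-> half_supp G u A.

(** The limit is taken coefficientwise: every coefficient of a Cauchy sequence is
    eventually constant. *)
Lemma from_level_complete (a : nat -> fsum K S) (C : R) :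
  (forall n m, (n <= m)%N -> from_level u (a m - a n) (n%:R + C)) ->
  exists l, forall n, from_level u (l - a n) (n%:R + C).
Proof.
move=> cauchy.
have same n m x : u x < n%:R + C -> u x < m%:R + C -> a n x = a m x.
  wlog nm : n m / (n <= m)%N => [th hn hm|hn _].
    by have [/th|/ltnW/th ->] := leqP n m; first apply.
  have /eqP := from_level_coef (cauchy n m nm) hn.
  by rewrite Defs.coefD Defs.coefN subr_eq0 => /eqP.
pose N (c : R) := Num.bound `|c - C|.
have NP c : c < (N c)%:R + C.
  by rewrite -ltrBlDr; apply: le_lt_trans (ler_norm _) (archi_boundP (normr_ge0 _)).
pose l x : K := a (N (u x)) x.
have Sl : l \in supported_in S.
  apply/asboolP/SE; split=> [x lx|c].
    by have /SE[+ _] := coef_supp (a (N (u x))); apply.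
  have /SE[_ /(_ c)] := coef_supp (a (N c)); apply: sub_finite_set.
  move=> x [lx lt]; split=> //; rewrite suppE (same (N c) (N (u x)))//.
  exact: lt_trans (NP c).
exists (FSum Sl) => n x; rewrite leNgt suppE Defs.coefD Defs.coefN /= => nz.
by apply: contra nz => lt; rewrite /l (same _ n) ?subrr.
Qed.
End Completeness.

Section Novikov.
Variables (R : realType) (K : fieldType) (G : zmodClosed R).

(** The valuation of [novikov_down] for which [- rho_down] is an ultranorm. *)
Definition val_down (a : novikov_down K G) : \bar R := (- nu_down a)%E.

Lemma from_level_up (a : novikov_up K G) c :
  (c%:E <= nu_up a)%E <-> from_level idfun a c.
Proof.
split=> [le x ax|le].
  by rewrite -lee_fin; apply: le_trans le _; apply: ereal_inf_lbound; exists x.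
by apply: le_ereal_inf_tmp => _ [x ax <-]; rewrite lee_fin; apply: le.
Qed.

Lemma from_level_down (a : novikov_down K G) c :
  (c%:E <= val_down a)%E <-> from_level -%R a c.
Proof.
rewrite /val_down leeNr; split=> [le x ax|le].
  by rewrite /= lerNr -lee_fin; apply: le_trans le; apply: ereal_sup_ubound; exists x.
by apply: ge_ereal_sup => _ [x ax <-]; rewrite -EFinN lee_fin lerNr; apply: le.
Qed.

Lemma nu_up_complete : complete_val (@nu_up R K G).
Proof.
move=> a C h.
have [|l lP] := @from_level_complete R K G (up_supports G) idfun (@up_half_supp R G) a C.
  by move=> n m nm; apply/from_level_up/h.
by exists l => n; apply/from_level_up/lP.
Qed.

Lemma val_down_complete : complete_val val_down.
Proof.
move=> a C h.
have [|l lP] := @from_level_complete R K G (down_supports G) -%R (@down_half_supp R G) a C.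
  by move=> n m nm; apply/from_level_down/h.
by exists l => n; apply/from_level_down/lP.
Qed.

Lemma nu_up_value (l : novikov_up K G) : l != 0 -> exists2 g, g \in G & nu_up l = g%:E.
Proof.
move=> /nu_up_min[g lg [-> _]]; exists g => //.
by have [+ _] := coef_supp l; apply.
Qed.

Lemma val_down_value (l : novikov_down K G) : l != 0 ->
  exists2 g, g \in G & val_down l = g%:E.
Proof.
move=> /nu_down_max[g lg [E _]]; exists (- g); last by rewrite /val_down E.
by rewrite rpredN; have [+ _] := coef_supp l; apply.
Qed.

Lemma val_down0 : val_down 0 = +oo%E.
Proof. by rewrite /val_down nu_down0. Qed.

Local Notation group_algebra := (group_algebra K G).

Lemma incl_up_inj : injective (@incl_up R K G).
Proof. exact: fsum_incl_inj. Qed.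

Lemma incl_down_inj : injective (@incl_down R K G).
Proof. exact: fsum_incl_inj. Qed.

Lemma support_bounds (a : group_algebra) : a != 0 -> exists p q, [/\ a p != 0, a q != 0,
    nu_up (incl_up a) = p%:E, nu_down (incl_down a) = q%:E
  & forall x, a x != 0 -> p <= x <= q].
Proof.
move=> a0; have [p ap [pE pmin]] := nu_up_min (rmorph_neq0 incl_up_inj a0).
have [q aq [qE qmax]] := nu_down_max (rmorph_neq0 incl_down_inj a0).
by exists p, q; split=> // x ax; rewrite pmin ?qmax.
Qed.

Lemma width_group_algebra (a : group_algebra) : a != 0 ->
  (nu_up (incl_up a) + val_down (incl_down a) <= 0)%E.
Proof.
move=> /support_bounds[p [q [ap _ pE qE pq]]]; rewrite /val_down pE qE -EFinN -EFinD lee_fin.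
by have /andP[_] := pq p ap; rewrite subr_le0.
Qed.

Lemma coef_in_G (a : group_algebra) x : a x != 0 -> x \in G.
Proof. by move=> ax; have [+ _] := coef_supp a; apply. Qed.

Fact monomial_fin_supported (c : K) g : g \in G ->
  monomial_fun c g \in supported_in (fin_supports G).
Proof.
move=> Gg; apply/asboolP; apply: (@fin_suppS _ _ _ [set g]%classic).
  by move=> x; rewrite suppE /monomial_fun; case: (x =P g); rewrite ?eqxx.
by split=> [x ->|].
Qed.

(** The element [c T^g] of the group algebra. *)
Definition monomial (c : K) g (Gg : g \in G) : group_algebra :=
  FSum (monomial_fin_supported c Gg).

Lemma coef_monomial c g (Gg : g \in G) x : monomial c Gg x = if x == g then c else 0.
Proof. by []. Qed.

Lemma coef_monomialM c g (Gg : g \in G) (a : group_algebra) x :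
  (monomial c Gg * a) x = c * a (x - g).
Proof.
have mE : incl_up (monomial c Gg) =
    FSum (@monomial_supported R K G (up_supports G) idfun (@up_half_supp R G) c g Gg).
  exact/fsumP.
have := @coef_mul_monomial R K G (up_supports G) idfun (@up_half_supp R G) (incl_up a) c g Gg x.
by rewrite -mE -rmorphM mulrC [c * _]mulrC.
Qed.

Lemma monomial_values c g (Gg : g \in G) : c != 0 ->
  nu_up (incl_up (monomial c Gg)) = g%:E /\ nu_down (incl_down (monomial c Gg)) = g%:E.
Proof.
move=> c0; have m0 : monomial c Gg != 0.
  by apply: contra c0 => /eqP/fsumP/(_ g); rewrite coef_monomial eqxx => ->.
have [p [q [mp mq -> -> _]]] := support_bounds m0.
by move: mp mq; rewrite !coef_monomial; case: (p =P g) => [->|]; case: (q =P g) => [->|];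
  rewrite ?eqxx.
Qed.

Lemma leading_terms_up :
  leading_terms (@nu_up R K G) val_down (@incl_up R K G) (@incl_down R K G).
Proof.
move=> l l0; have [g lg [E gmin]] := nu_up_min l0.
have Gg : g \in G by have [+ _] := coef_supp l; apply.
have [m1 m2] := monomial_values Gg lg.
exists (monomial (l g) Gg), g; split=> //; first by rewrite /val_down m2.
have [->|d0] := eqVneq (l - incl_up (monomial (l g) Gg)) 0; first by rewrite nu_up0 ltry.
have [h + [-> _]] := nu_up_min d0; rewrite suppE Defs.coefD Defs.coefN /= /monomial_fun lte_fin.
have [->|hg] := eqVneq h g; first by rewrite subrr eqxx.
by rewrite subr0 lt_neqAle [g == h]eq_sym hg => /gmin.
Qed.

Lemma leading_terms_down :
  leading_terms val_down (@nu_up R K G) (@incl_down R K G) (@incl_up R K G).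
Proof.
move=> l l0; have [g lg [E gmax]] := nu_down_max l0.
have Gg : g \in G by have [+ _] := coef_supp l; apply.
have [m1 m2] := monomial_values Gg lg.
exists (monomial (l g) Gg), (- g); split=> //.
- by rewrite /val_down E.
- by rewrite /val_down m2.
- by rewrite opprK.
have [->|d0] := eqVneq (l - incl_down (monomial (l g) Gg)) 0.
  by rewrite /val_down nu_down0 ltry.
have [h + [hE _]] := nu_down_max d0; rewrite /val_down hE suppE Defs.coefD Defs.coefN /=.
rewrite /monomial_fun lte_fin ltrN2.
have [->|hg] := eqVneq h g; first by rewrite subrr eqxx.
by rewrite subr0 lt_neqAle hg => /gmax.
Qed.

(** One-sided division, for [u] the identity or the opposite. The exponent [q] of
    [a] is the greatest for [u]; the terms of [b] with an exponent in [q + U] are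
    cancelled, from the greatest downwards, by multiples of [T^t a] with [t] in [U].
    Coefficients out of reach of these multiples are unchanged. *)
Section Reduce.
Variables (eps : R) (u : {additive R -> R}) (U : R -> Prop) (t0 : R).
Variables (a : group_algebra) (q : R).
Hypotheses (eps0 : 0 < eps) (sepG : separated_by G eps).
Hypotheses (u_norm : forall x, `|u x| = `|x|)
  (U_lb : forall t, U t -> t0 <= u t).
Hypotheses (aq : a q != 0) (amax : forall x, a x != 0 -> u x <= u q).

(** Each step lowers by [eps] a bound on the terms to be cancelled. *)
Lemma reduce_steps n (b : group_algebra) :
  (forall x, b x != 0 -> U (x - q) -> u x < t0 + u q + n%:R * eps) ->
  exists c, (forall x, (b - c * a) x != 0 -> ~ U (x - q)) /\
    (forall x, (forall y, a y != 0 -> ~ U (x - y)) -> (b - c * a) x = b x).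
Proof.
elim: n b => [|n IH] b bn.
  exists 0; rewrite mul0r subr0; split=> // x bx Ux; have := bn x bx Ux.
  by rewrite mul0r addr0 ltNge -lerBrDr -raddfB U_lb.
have [[x [bx Ux xn]]|none] := pselect (exists x,
    [/\ b x != 0, U (x - q) & t0 + u q + n%:R * eps <= u x]); last first.
  apply: IH => x bx Ux; rewrite ltNge; apply/negP => xn.
  by apply: none; exists x.
(* at most one exponent of [G] lies in the range dealt with at this step *)
have near y : y \in G -> t0 + u q + n%:R * eps <= u y ->
    u y < t0 + u q + n.+1%:R * eps -> y = x.
  move=> Gy yn yn1; apply/eqP; rewrite -subr_eq0; apply/eqP/sepG.
    by rewrite rpredB//; apply: coef_in_G bx.
  rewrite -u_norm raddfB ltr_norml.
  have := bn x bx Ux; move: yn yn1 xn; rewrite -natr1 mulrDl mul1r.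
  by move=> *; apply/andP; split; lra.
have Gxq : x - q \in G by rewrite rpredB// (coef_in_G bx, coef_in_G aq).
pose m := monomial (b x / a q) Gxq.
have mE y : (b - m * a) y = b y - b x / a q * a (y - x + q).
  by rewrite Defs.coefD Defs.coefN coef_monomialM opprB addrA addrAC.
have [|c [c1 c2]] := IH (b - m * a).
  move=> y + Uy; rewrite ltNge; apply: contraNN => yn; rewrite mE.
  have [->|yx] := eqVneq y x.
    by rewrite subrr add0r divfK// subrr.
  have by0 : b y = 0.
    apply/eqP; apply: contra_neqT yx => nz.
    by apply: near => //; [exact: coef_in_G nz|exact: bn].
  have ay0 : a (y - x + q) = 0.
    apply/eqP; apply: contra_neqT yx => nz.
    have := amax nz; rewrite raddfD gerDr raddfB subr_le0 => le.
    apply: near => //; last by apply: le_lt_trans le (bn x bx Ux).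
    have := coef_in_G nz => h.
    rewrite -(subrK x y) rpredD ?(coef_in_G bx)// -(addrK q (y - x)).
    by rewrite rpredB// (coef_in_G aq).
  by rewrite by0 ay0 mulr0 subr0.
exists (m + c); rewrite mulrDl opprD addrA; split=> // y Uy.
rewrite c2// mE (_ : a (y - x + q) = 0) ?mulr0 ?subr0//.
apply/eqP; apply: contraPT Ux => nz; have := Uy _ nz.
by rewrite (_ : y - (y - x + q) = x - q)//; lra.
Qed.

Lemma reduce (b : group_algebra) :
  exists c, (forall x, (b - c * a) x != 0 -> ~ U (x - q)) /\
    (forall x, (forall y, a y != 0 -> ~ U (x - y)) -> (b - c * a) x = b x).
Proof.
have [_ /finite_seqP[s sE]] := coef_supp b.
pose M := \sum_(x <- s) `|u x|.
apply: (@reduce_steps (Num.bound (`|M - t0 - u q| / eps))) => x bx _.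
have xM : u x <= M.
  have : x \in s by have : [set` s]%classic x by rewrite -sE.
  move=> /(big_rem x) E; rewrite /M E /=; apply: le_trans (ler_norm _) _.
  by rewrite lerDl sumr_ge0.
have := archi_boundP (divr_ge0 (normr_ge0 (M - t0 - u q)) (ltW eps0)).
rewrite ltr_pdivrMr//; have := ler_norm (M - t0 - u q); lra.
Qed.
End Reduce.

(** The terms of [b] above the window are cancelled first, then those below it;
    the second pass does not affect exponents above the window. *)
Lemma window_division_group_algebra eps : 0 < eps -> separated_by G eps ->
  window_division (@nu_up R K G) val_down (@incl_up R K G) (@incl_down R K G).
Proof.
move=> eps0 sepG a b s a0.
have [p [q [ap aq pE qE pq]]] := support_bounds a0.
have le_q x : a x != 0 -> x <= q by move=> /pq/andP[].
have ge_p x : a x != 0 -> - x <= - p by move=> /pq/andP[]; rewrite lerN2.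
have lb t : t < s -> - s <= - t by move=> ts; rewrite lerN2 ltW.
have [c1 [c1q _]] := @reduce eps idfun (fun t => s <= t) s a q eps0 sepG
  (fun x => erefl) (fun t st => st) aq le_q b.
have [c2 [c2p c2q]] := @reduce eps -%R (fun t => t < s) (- s) a p eps0 sepG
  (@normrN _ _) lb ap ge_p (b - c1 * a).
exists (c1 + c2); rewrite pE /val_down qE mulrDl opprD addrA.
set d := b - c1 * a - c2 * a in c2p c2q *.
have dp x : d x != 0 -> s + p <= x.
  by move=> /c2p /negP; rewrite -leNgt lerBrDr.
have dq x : d x != 0 -> x < s + q.
  move=> dx; rewrite ltNge; apply/negP => sx.
  have dE : d x = (b - c1 * a) x.
    apply: c2q => y /pq/andP[_ yq]; apply/negP; rewrite -leNgt.
    by rewrite lerBrDr; apply: le_trans sx; rewrite lerD2l.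
  by apply: (c1q x); [rewrite -dE|rewrite lerBrDr].
split; first by rewrite -EFinD; apply/from_level_up => x /dp.
rewrite -EFinN -EFinD -opprD EFinN lteN2.
have [d0|d0] := eqVneq (incl_down d) 0.
  by apply: le_lt_trans (ltNyr (s + q)); rewrite -(nu_down0 K G) -d0.
have [g dg [E _]] := nu_down_max d0.
by apply: le_lt_trans (_ : (g%:E < (s + q)%:E)%E); [rewrite -E|rewrite lte_fin dq].
Qed.
End Novikov.

(** * Doubly-orthogonal bases *)

Section NormTranslation.
Variables (R : realType) (K : fieldType) (G : zmodClosed R).

(** [rho_up] as an ultranorm for [nu_up]. *)
Definition ultranorm_up (V : vectType (novikov_up K G)) (rho : norm_up V) :
    ultranorm (@nu_up R K G) V :=
  Ultranorm (rho_up_fin rho) (rho_up_eqNy rho) (rho_upZ rho) (rho_upD rho).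

Section Down.
Variables (V : vectType (novikov_down K G)) (rho : norm_down V).
Local Open Scope ereal_scope.

Fact down_fin x : - rho x != +oo.
Proof. by rewrite eqe_oppLR; exact: rho_down_fin. Qed.

Fact down_eqNy x : - rho x = -oo <-> x = 0%R.
Proof.
split=> [/eqP|/(rho_down_eqy rho) -> //].
by rewrite eqe_oppLR => /eqP/(rho_down_eqy rho).
Qed.

Fact down_Z (l : novikov_down K G) x : - rho (l *: x)%R = - rho x - val_down l.
Proof.
rewrite rho_downZ /val_down oppeK.
have := rho_down_fin rho x.
have [->|/nu_down_max[g _ [-> _]]] := eqVneq l 0%R.
  by rewrite nu_down0; case: (rho x).
by case: (rho x) => //= r _; rewrite opprB addrC.
Qed.

Fact down_D x y : - rho (x + y)%R <= maxe (- rho x) (- rho y).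
Proof. by rewrite -oppe_min leeN2 rho_downD. Qed.

(** [- rho_down] as an ultranorm for [- nu_down]. *)
Definition ultranorm_down : ultranorm (@val_down R K G) V :=
  Ultranorm down_fin down_eqNy down_Z down_D.
End Down.
End NormTranslation.

(** The norm of a combination of orthogonal vectors is the maximum of the norms of
    its terms. *)
Lemma orthogonal_max (R : realType) (F : fieldType) (v : F -> \bar R)
    (V : vectType F) (r : ultranorm v V) n (X : n.-tuple V) (l : 'I_n -> F) :
  orthogonal_seq r X ->
  r (\sum_(i < n) l i *: tnth X i) = (\big[maxe/-oo]_(i < n) (r (tnth X i) - v (l i)))%E.
Proof.
move=> oX; pose l' j := if insub j is Some i then l i else 0.
have l'E (i : 'I_n) : l' i = l i by rewrite /l' valK.
have sumE : \sum_(i < n) l i *: tnth X i = lincomb X l'.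
  rewrite /lincomb size_tuple; apply: eq_bigr => i _.
  by rewrite l'E (tnth_nth 0).
apply/le_anti/andP; split.
  apply: nrm_sum_le => i _; rewrite nrmZ.
  by rewrite (bigD1 i)//= le_max lexx.
rewrite sumE; elim/big_ind: _; first exact: leNye.
  by move=> x y xr yr; rewrite ge_max xr.
move=> i _; rewrite -nrmZ -l'E (tnth_nth 0).
by apply: oX; rewrite size_tuple.
Qed.

Section Orthogonality.
Variables (R : realType) (K : fieldType) (G : zmodClosed R).

Lemma orthogonal_up_seq (V : vectType (novikov_up K G)) (rho : norm_up V) n (X : n.-tuple V) :
  orthogonal_seq (ultranorm_up rho) X -> orthogonal_up rho X.
Proof. by move=> oX l; exact: (orthogonal_max l oX). Qed.

Lemma orthogonal_down_seq (V : vectType (novikov_down K G)) (rho : norm_down V) n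
    (X : n.-tuple V) :
  orthogonal_seq (ultranorm_down rho) X -> orthogonal_down rho X.
Proof.
move=> oX l; apply: oppe_inj; rewrite [LHS](orthogonal_max l oX).
rewrite (big_morph (-%E)%E oppe_min (erefl : (- +oo = -oo)%E)).
apply: eq_bigr => i _; rewrite -down_Z rho_downZ//.
Qed.
End Orthogonality.

(** The interchange of the two norms. *)
Lemma successive_minimaC (R : realType) (A : idomainType) (H : lmodType A)
    (F1 F2 : fieldType) (v1 : F1 -> \bar R) (v2 : F2 -> \bar R)
    (i1 : {rmorphism A -> F1}) (i2 : {rmorphism A -> F2})
    (V1 : vectType F1) (V2 : vectType F2) (r1 : ultranorm v1 V1) (r2 : ultranorm v2 V2)
    (phi1 : {linear H -> V1 | i1 \; *:%R}) (phi2 : {linear H -> V2 | i2 \; *:%R}) e lam :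
  successive_minima r1 r2 phi1 phi2 e lam -> successive_minima r2 r1 phi2 phi1 e lam.
Proof.
move=> [mono vals min]; split=> //.
  by move=> j /vals[p [q [pE qE E]]]; exists q, p; rewrite addrC.
move=> j y a b lt a0 ayE bj b0 p q yp yq; rewrite addrC.
exact: min lt a0 ayE bj b0 _ _ yq yp.
Qed.

Theorem theorem5p5 (R : realType) (K : fieldType) (G : zmodClosed R)
  (fgG : fin_gen_subgroup G) (dG : discrete_subgroup G)
  (P : filtered_matched_pair K G) :
  exists (d : nat) (e : d.-tuple P), doubly_orthogonal_basis e.
Proof.
have [eps eps0 sepG] := discrete_separated dG.
case: P => H fgH V1 rho1 V2 rho2 phi1 phi2 bij1 bij2.
pose r1 := ultranorm_up rho1; pose r2 := ultranorm_down rho2.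
have inj1 := @incl_up_inj R K G; have inj2 := @incl_down_inj R K G.
have [e [lam [e1_indep e1_span e_min]]] := minima_exist eps0 sepG (nu_up0 K G) (val_down0 K G)
  (@nu_up_value R K G) (@val_down_value R K G) (@nu_up_complete R K G)
  (@val_down_complete R K G) inj1 inj2 (@width_group_algebra R K G) r1 r2 fgH bij1 bij2.
have e_indep : lin_indep e := indep_of_phi inj1 e1_indep.
have e2_indep := indep_phi inj2 fgH bij2 e_indep.
have [t [a [et_indep a0 ae]]] := maximal_family fgH e_indep.
(* the images of [e] already span [V1], so the extension of [e] is trivial *)
have t0 : t = [::].
  have /free_lin_indep := indep_phi inj1 fgH bij1 et_indep.
  rewrite /free => /eqP E; have := dimvS (subvf <<map phi1 (e ++ t)>>).
  rewrite E -e1_span => /leq_trans/(_ (dim_span _)).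
  by rewrite !size_map size_cat -[leqRHS]addn0 leq_add2l leqn0 => /nilP.
rewrite t0 cats0 in ae.
have gen : forall x, exists c, x - lincomb e c \in @torsion _ H.
  apply: (minima_generate _ _ (window_division_group_algebra eps0 sepG) e_min a0 ae).
    by move=> c /(rmorph_neq0 inj1)/nu_up_value[g _ gE]; exists g.
  by move=> c /(rmorph_neq0 inj2)/val_down_value[g _ gE]; exists g.
have e2_span : <<map phi2 e>>%VS = fullv.
  apply: (span_phi bij2) => x; have [c /(torsion_phi inj2 phi2)] := gen x.
  by move/eqP; rewrite linearB subr_eq0 => /eqP ->; rewrite phi_lincomb lincomb_span.
exists (size e), (in_tuple e); split; [split|split|split].
- move=> c c0 j; pose c' k := if insub k is Some k' then c k' else 0.
  have c'E (k : 'I_(size e)) : c' k = c k by rewrite /c' valK.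
  rewrite -c'E; apply: (inj1); rewrite rmorph0.
  apply: (e1_indep (fun k => incl_up (c' k))); last by rewrite size_map.
  rewrite -[LHS](phi_lincomb phi1 e c'); apply/(torsion_phi inj1).
  rewrite -[lincomb _ _]subr0; apply/proj_torsionP.
  rewrite -[proj_torsion 0]/(@proj_torsion _ H 0) linear0 -[RHS]c0 /lincomb linear_sum.
  by apply: eq_bigr => k _; rewrite linearZ /= tnth_map c'E (tnth_nth 0).
- elim/mod_torsion_ind => x; have [c xc] := gen x; exists (fun i => c i).
  move/proj_torsionP: xc => ->; rewrite /lincomb linear_sum.
  by apply: eq_bigr => i _; rewrite linearZ /= tnth_map (tnth_nth 0).
- by rewrite /basis_of e1_span eqxx; apply/free_lin_indep.
- apply: orthogonal_up_seq.
  exact: (minima_orthogonal (nu_up0 K G) (@nu_up_value R K G) (@leading_terms_up R K G) e_min).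
- by rewrite /basis_of e2_span eqxx; apply/free_lin_indep.
- apply: orthogonal_down_seq.
  exact: (minima_orthogonal (val_down0 K G) (@val_down_value R K G) (@leading_terms_down R K G)
    (successive_minimaC e_min)).
Qed.
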